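(* Let $\{\epsilon_t\}_{t\ge 1}$ be a sequence of i.i.d. random variables with $E(\epsilon_t)=0$, $0<E(\epsilon_t^2)=\sigma^2<\infty$ and $E|\epsilon_t|^\alpha<\infty$ for some $\alpha>2$. Let $\{y_t\}$ be the AR($p$) process $$y_t=\beta_1y_{t-1}+\cdots+\beta_py_{t-p}+\epsilon_t,\qquad t\ge 1,$$ with real coefficients $\beta_1,\dots,\beta_p$, where the initial values $(y_0,\ldots,y_{1-p})$ are independent of $\{\epsilon_t\}$. Assume that the characteristic polynomial factors as $$\phi(z)=1-\beta_1z-\cdots-\beta_pz^p=(1-z)(1+z)\Psi(z),$$ where $\Psi(z)=1-\Psi_1z-\cdots-\Psi_qz^q$ is a polynomial of order $q=p-2$ which has all its roots outside the unit circle. Put $\boldsymbol{y}_t=(y_t,\ldots,y_{t-p+1})'$. Then $$\lim_{T\to\infty}\frac{1}{\log T}\log\det\Big(\sum_{t=1}^{T}\boldsymbol{y}_t\boldsymbol{y}_t'\Big)=p+2\quad\text{almost surely.}$$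
   Context: A prime denotes transpose, so $\boldsymbol{y}_t$ is a $p$-dimensional column vector and $\boldsymbol{y}_t\boldsymbol{y}_t'$ is a $p\times p$ matrix. ''Outside the unit circle'' means of modulus strictly greater than $1$. *)

(* Defs.v *)
From HB Require Import structures.
From mathcomp Require Import all_boot all_order all_algebra finmap.
From mathcomp Require Import complex.
From mathcomp Require Import all_classical all_reals all_analysis.

Set Implicit Arguments.
Unset Strict Implicit.
Unset Printing Implicit Defensive.

Import Order.TTheory GRing.Theory Num.Theory.
Import numFieldNormedType.Exports.

Local Open Scope classical_set_scope.
Local Open Scope ring_scope.

Definition mutually_independent d (T : measurableType d) (R : realType)
    (P : probability T R) (I : choiceType) (J : set I) (X : I -> {RV P >-> R}) :
    Prop :=
  forall (F : {fset I}) (B : I -> set R),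
    [set` F] `<=` J -> (forall i, measurable (B i)) ->
    P (\bigcap_(i in [set` F]) (X i @^-1` B i)) =
    (\prod_(i <- enum_fset F) P (X i @^-1` B i))%E.

Definition identically_distributed d (T : measurableType d) (R : realType)
    (P : probability T R) (I : Type) (J : set I) (X : I -> {RV P >-> R}) :
    Prop :=
  forall i j, J i -> J j -> forall B : set R, measurable B ->
    distribution P (X i) B = distribution P (X j) B.

Definition sigma_rv d (T : measurableType d) (R : realType)
    (P : probability T R) (I : Type) (J : set I) (X : I -> {RV P >-> R}) :
    set (set T) :=
  <<s \bigcup_(i in J) preimage_set_system setT (X i) measurable >>.

Definition independent_families d (T : measurableType d) (R : realType)
    (P : probability T R) (I1 I2 : Type) (J1 : set I1) (X1 : I1 -> {RV P >-> R})
    (J2 : set I2) (X2 : I2 -> {RV P >-> R}) : Prop :=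
  forall A B : set T, sigma_rv J1 X1 A -> sigma_rv J2 X2 B ->
    P (A `&` B) = (P A * P B)%E.

(* 1 - b_1 X - ... - b_n X^n; the value b 0 is not used. *)
Definition ar_poly (R : nzRingType) (n : nat) (b : nat -> R) : {poly R} :=
  1 - \sum_(1 <= i < n.+1) b i *: 'X^i.

(* The column vector (y_t, ..., y_{t-p+1})' for a path y indexed by int. *)
Definition lag_vector (R : Type) (p : nat) (y : int -> R) (t : nat) : 'cV[R]_p :=
  \col_(i < p) y (t%:Z - i%:Z).

Definition lag_gram (R : nzRingType) (p : nat) (y : int -> R) (n : nat) :
    'M[R]_p :=
  \sum_(1 <= t < n.+1) lag_vector p y t *m (lag_vector p y t)^T.

(* Main.v *)
(* Write [B] for the lag operator, [u = Psi(B)(1 + B) y] and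
   [v = Psi(B)(1 - B) y]: up to the sign [(-1)^t] these are random walks driven
   by the noise. In the basis [1, X, X^2 - 1, X^3 - X, ...] of polynomials of
   degree [< p], the Gram matrix has the same determinant and its quadratic
   form is [Q(c) = sum_t (c(B) y_t)^2]. All bounds hold up to factors [n^dl].
   Lower bound: filtering by [Psi(B)(1 - B^2)] gives
   [n |c|^2 <= Q(c)], because [c(B) eps] has a nondegenerate Gram matrix, and
   filtering by [Psi(B)(1 + B)] gives [c(1)^2 sum u^2 <= Q(c) + |c|^2 n], hence
   [c(1)^2 n^2 <= Q(c)]; likewise for [v] and [c(-1)]. So [Q] dominates a
   diagonal form with entries [n^2, n^2, n, ..., n], of determinant [n^(p+2)].
   Upper bound: Hadamard's inequality, as [Psi(B) y = (u + v) / 2] and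
   [Psi(B)(1 - B^2) y = eps] are stable recursions.
   The bounds on the noise are second moment estimates for martingale
   transforms, with Borel-Cantelli along [n = 2^k] and monotonicity in [n].
   Only second moments are needed: [sum S^2 >= n^(2-dl)] for the random walk
   [S] follows from [S_t^2 = 2 sum_(s <= t) S_(s-1) eps_s + sum_(s <= t) eps_s^2],
   whose martingale part is negligible if [sum S^2] is too small. *)
Require Import Defs.
From HB Require Import structures.
From mathcomp Require Import all_boot all_order all_algebra finmap.
From mathcomp Require Import complex.
From mathcomp Require Import all_classical all_reals all_analysis.
From mathcomp Require Import measurable_realfun.
From mathcomp Require Import ring lra zify.

Import Order.TTheory GRing.Theory Num.Theory.
Import numFieldNormedType.Exports.

Set Implicit Arguments.
Unset Strict Implicit.
Unset Printing Implicit Defensive.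

Local Open Scope classical_set_scope.
Local Open Scope ring_scope.

(** * Cauchy-Schwarz inequalities for finite sums *)

Lemma sum_cauchy_schwarz (R : realFieldType) (n : nat) (a b : 'I_n -> R) :
  (\sum_i a i * b i) ^+ 2 <= (\sum_i a i ^+ 2) * (\sum_i b i ^+ 2).
Proof.
(* Lagrange's identity: this nonnegative double sum is twice the gap between the two sides. *)
have h : 0 <= \sum_i \sum_j (a i * b j - a j * b i) ^+ 2.
  by apply: sumr_ge0 => i _; apply: sumr_ge0 => j _; exact: sqr_ge0.
have e (f g : 'I_n -> R) :
    (\sum_i f i) * (\sum_i g i) = \sum_i \sum_j f i * g j.
  by rewrite big_distrl; apply: eq_bigr => i _; rewrite big_distrr.
have : \sum_i \sum_j (a i * b j - a j * b i) ^+ 2 =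
    \sum_i \sum_j a i ^+ 2 * b j ^+ 2 + \sum_i \sum_j b i ^+ 2 * a j ^+ 2
    - 2 * \sum_i \sum_j (a i * b i) * (a j * b j).
  rewrite mulr_sumr -big_split -sumrB; apply: eq_bigr => i _ /=.
  rewrite mulr_sumr -big_split -sumrB; apply: eq_bigr => j _ /=.
  by ring.
rewrite -!e => eq; rewrite eq in h.
rewrite expr2; lra.
Qed.

Lemma sqr_sum_le (R : realFieldType) (n : nat) (b : 'I_n -> R) :
  (\sum_i b i) ^+ 2 <= n%:R * (\sum_i b i ^+ 2).
Proof.
have := sum_cauchy_schwarz (fun=> 1) b.
under eq_bigr do rewrite mul1r.
under [X in _ <= X * _]eq_bigr do rewrite expr1n.
by rewrite sumr_const card_ord.
Qed.

Lemma row_mulmx_sqr_le (R : realFieldType) (n : nat) (B : 'M[R]_n) :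
  exists2 K : R, 0 <= K & forall x : 'rV[R]_n,
    \sum_j (x *m B) 0 j ^+ 2 <= K * \sum_i x 0 i ^+ 2.
Proof.
(* The squared Frobenius norm of [B]. *)
exists (\sum_j \sum_i B i j ^+ 2) => [|x].
  by do 2![apply: sumr_ge0 => ? _]; exact: sqr_ge0.
rewrite mulr_suml; apply: ler_sum => j _.
by rewrite mxE mulrC; exact: sum_cauchy_schwarz.
Qed.

(** * Lag polynomials *)

(* The series [a(B) x], where [B] is the lag operator [(B x)_t = x_(t-1)] *)
Definition lag (R : comNzRingType) (a : {poly R}) (x : int -> R) (t : int) : R :=
  \sum_(i < size a) a`_i * x (t - i%:Z).

Section Lag.
Variable R : comNzRingType.
Implicit Types (a b : {poly R}) (x : int -> R) (t : int).

Lemma lagE n a x t : (size a <= n)%N ->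
  lag a x t = \sum_(i < n) a`_i * x (t - i%:Z).
Proof.
move=> h; rewrite /lag (big_ord_widen _ (fun i => a`_i * x (t - i%:Z)) h).
rewrite [RHS](bigID (fun i : 'I_n => (i < size a)%N)) /= [X in _ + X]big1 ?addr0//.
by move=> i; rewrite -leqNgt => hi; rewrite nth_default ?mul0r.
Qed.

Lemma lagD a b x t : lag (a + b) x t = lag a x t + lag b x t.
Proof.
rewrite (@lagE (maxn (size a) (size b))) ?size_polyD//.
rewrite (@lagE _ a _ _ (leq_maxl _ (size b))) (@lagE _ b _ _ (leq_maxr (size a) _)).
by rewrite -big_split; apply: eq_bigr => i _; rewrite coefD mulrDl.
Qed.

Lemma lagZ k a x t : lag (k *: a) x t = k * lag a x t.
Proof.
rewrite (@lagE (size a)) ?size_scale_leq// /lag mulr_sumr.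
by apply: eq_bigr => i _; rewrite coefZ mulrA.
Qed.

Lemma lagN a x t : lag (- a) x t = - lag a x t.
Proof. by rewrite -scaleN1r lagZ mulN1r. Qed.

Lemma lag0 x t : lag 0 x t = 0.
Proof. by rewrite /lag size_poly0 big_ord0. Qed.

Lemma lagC k x t : lag k%:P x t = k * x t.
Proof. by rewrite (@lagE 1) ?size_polyC_leq1// big_ord1 coefC eqxx subr0. Qed.

Lemma lag_sum I (s : seq I) (F : I -> {poly R}) x t :
  lag (\sum_(i <- s) F i) x t = \sum_(i <- s) lag (F i) x t.
Proof.
by elim: s => [|i s IH]; rewrite ?big_nil ?lag0// !big_cons lagD IH.
Qed.

Lemma lagMX a x t : lag (a * 'X) x t = lag a x (t - 1).
Proof.
rewrite (@lagE (size a).+1); last first.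
  by rewrite (leq_trans (size_polyMleq _ _))// size_polyX addn2.
rewrite big_ord_recl coefMX eqxx mul0r add0r; apply: eq_bigr => i _.
rewrite coefMX /=; congr (_ * x _); rewrite /bump /=; lia.
Qed.

Lemma lagX x t : lag 'X x t = x (t - 1).
Proof. by rewrite -['X]mul1r lagMX -[1]/(1%:P) lagC mul1r. Qed.

Lemma lagXn n x t : lag 'X^n x t = x (t - n%:Z).
Proof.
elim: n t => [|n IH] t; first by rewrite expr0 -[1]/(1%:P) lagC mul1r subr0.
by rewrite exprSr lagMX IH; congr (x _); lia.
Qed.

Lemma lagM a b x t : lag (a * b) x t = lag a (lag b x) t.
Proof.
elim/poly_ind: a t => [|a c IH] t; first by rewrite mul0r !lag0.
rewrite mulrDl lagD -mulrA ['X * b]mulrC mulrA lagMX IH mul_polyC lagZ.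
by rewrite lagD lagMX lagC.
Qed.

Lemma lag_ar_poly n (b : nat -> R) x t :
  lag (ar_poly n b) x t = x t - \sum_(1 <= i < n.+1) b i * x (t - i%:Z).
Proof.
rewrite /ar_poly lagD -[1]/(1%:P) lagC mul1r lagN lag_sum.
by congr (_ - _); apply: eq_bigr => i _; rewrite lagZ lagXn.
Qed.

End Lag.

Lemma lag_map (R S : comNzRingType) (f : {rmorphism R -> S}) (a : {poly R})
    (x : int -> R) t :
  lag (map_poly f a) (f \o x) t = f (lag a x t).
Proof.
rewrite (@lagE _ (size a)) ?size_poly// rmorph_sum; apply: eq_bigr => i _.
by rewrite coef_map rmorphM.
Qed.

(** The late start [N.+1] keeps the times positive even after the shift [i <= N], so the terms on
    the left are among those on the right and no value of [x] at a time [<= 0] enters. *)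
Lemma sum_shift_le (R : realFieldType) (x : int -> R) (N n i : nat) :
  (i <= N)%N -> (forall t, 0 <= x t) ->
  \sum_(N.+1 <= t < n.+1) x (t%:Z - i%:Z) <= \sum_(1 <= t < n.+1) x t%:Z.
Proof.
move=> iN x0.
have [nN|Nn] := leqP n N; first by rewrite big_geq// sumr_ge0.
have e : N.+1 = ((N - i).+1 + i)%N by lia.
rewrite e big_addn.
rewrite (@big_cat_nat _ _ _ (n.+1 - i) 1 n.+1)/=; [|lia..].
rewrite (@big_cat_nat _ _ _ (N - i).+1 1 (n.+1 - i))/=; [|lia..].
rewrite -addrA [leRHS]addrC -addrA.
rewrite (eq_bigr (fun t => x t%:Z)); last by move=> t _; congr (x _); lia.
by rewrite ler_wpDr// addr_ge0 ?sumr_ge0.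
Qed.

(** Cauchy-Schwarz in the coefficients, then each shifted sum is at most the unshifted one. [K] has
    to be uniform in [x]: it will be applied to [lag c y] with arbitrary coefficients [c]. *)
Lemma lag_sqr_sum_le (R : realFieldType) (a : {poly R}) (N : nat) :
  (size a <= N.+1)%N ->
  exists2 K : R, 0 <= K & forall (x : int -> R) n,
    \sum_(N.+1 <= t < n.+1) lag a x t%:Z ^+ 2 <=
    K * \sum_(1 <= t < n.+1) x t%:Z ^+ 2.
Proof.
move=> sa; exists ((\sum_(i < N.+1) a`_i ^+ 2) * N.+1%:R) => [|x n].
  by rewrite mulr_ge0// sumr_ge0// => i _; exact: sqr_ge0.
apply: (@le_trans _ _ (\sum_(N.+1 <= t < n.+1)
   (\sum_(i < N.+1) a`_i ^+ 2) * (\sum_(i < N.+1) x (t%:Z - i%:Z) ^+ 2))).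
  by apply: ler_sum => t _; rewrite (lagE _ _ sa); exact: sum_cauchy_schwarz.
rewrite -mulr_sumr exchange_big /= -mulrA ler_wpM2l//.
  by rewrite sumr_ge0// => i _; exact: sqr_ge0.
apply: (@le_trans _ _ (\sum_(i < N.+1) \sum_(1 <= t < n.+1) x t%:Z ^+ 2)).
  apply: ler_sum => i _; apply: (@sum_shift_le _ (fun t => x t ^+ 2)).
    by rewrite -ltnS.
  by move=> t; exact: sqr_ge0.
by rewrite sumr_const card_ord mulr_natl.
Qed.

(** * Determinants of symmetric matrices *)

(** Block elimination of the corner [a] leaves its Schur complement. *)
Lemma sym_block_det (R : fieldType) (n : nat) (a : R) (b : 'rV[R]_n) (C : 'M[R]_n) :
  a != 0 ->
  \det (block_mx a%:M b b^T C) = a * \det (C - a^-1 *: (b^T *m b)).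
Proof.
move=> a0; set S := C - _.
have -> : block_mx a%:M b b^T C =
    block_mx 1%:M 0 (a^-1 *: b^T) 1%:M *m block_mx a%:M b 0 S.
  rewrite mulmx_block !mul1mx !mul0mx !addr0; congr block_mx.
    by rewrite mul_mx_scalar scalerA divff// scale1r.
  by rewrite -scalemxAl /S addrC subrK.
by rewrite det_mulmx det_lblock det_ublock !det1 !mul1r det_scalar1.
Qed.

(** The first coordinate of [x] is chosen to make the first entry of [x *m block_mx a%:M b b^T C]
    vanish. Lower bounds on the full form thus pass to the Schur complement. *)
Lemma sym_block_quad (R : fieldType) (n : nat) (a : R) (b y : 'rV[R]_n)
    (C : 'M[R]_n) :
  a != 0 ->
  let x := row_mx (- (a^-1 *: (y *m b^T))) y in
  x *m block_mx a%:M b b^T C *m x^T = y *m (C - a^-1 *: (b^T *m b)) *m y^T.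
Proof.
move=> a0 /=; rewrite mul_row_block mul_mx_scalar scalerN scalerA divff// scale1r.
rewrite addNr tr_row_mx mul_row_col mul0mx add0r; congr (_ *m _).
by rewrite mulmxBr -scalemxAr mulmxA mulNmx -scalemxAl addrC.
Qed.

Lemma quad_diag_le (R : realFieldType) (n : nat) (A : 'M[R]_n) (d : 'I_n -> R) k :
  (forall i, 0 < d i) ->
  (forall x : 'rV[R]_n, \sum_i d i * x 0 i ^+ 2 <= (x *m A *m x^T) 0 0) ->
  d k <= A k k.
Proof.
move=> d0 /(_ (delta_mx 0 k)); rewrite (bigD1 k)//= mxE !eqxx expr1n mulr1.
rewrite -rowE trmx_delta -colE !mxE; apply: le_trans; rewrite lerDl.
by apply: sumr_ge0 => i _; rewrite mulr_ge0 ?sqr_ge0// ltW.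
Qed.

(** Induction on the size through the Schur complement [S] of the first diagonal entry. [S] inherits
    the lower bound on the form, and its diagonal entries are at most those of [A], since a square
    over [a] is subtracted. The upper bound is Hadamard's inequality. *)
Lemma sym_det_bounds (R : realFieldType) (n : nat) (A : 'M[R]_n)
    (d : 'I_n -> R) :
  A^T = A -> (forall i, 0 < d i) ->
  (forall x : 'rV[R]_n, \sum_i d i * x 0 i ^+ 2 <= (x *m A *m x^T) 0 0) ->
  \prod_i d i <= \det A <= \prod_i A i i.
Proof.
elim: n A d => [|n IH] A d symA d0 Ad; first by rewrite det_mx00 !big_ord0 lexx.
pose a := A 0 0; pose b := ursubmx (A : 'M[R]_(1 + n)).
pose C := drsubmx (A : 'M[R]_(1 + n)); pose S := C - a^-1 *: (b^T *m b).
have eA : A = block_mx a%:M b b^T C :> 'M[R]_(1 + n).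
  rewrite -[LHS](@submxK _ 1 n 1 n); congr block_mx.
    by apply/matrixP => i j; rewrite !ord1 !mxE eqxx mulr1n !lshift0.
  by rewrite /b trmx_ursub symA.
have da : d 0 <= a := quad_diag_le 0 d0 Ad.
have a0 : 0 < a by apply: lt_le_trans da.
have aN0 : a != 0 by rewrite gt_eqF.
have symS : S^T = S.
  rewrite /S linearB linearZ /= trmx_mul trmxK; congr (_ - _).
  by rewrite /C trmx_drsub symA.
have Sd (y : 'rV[R]_n) :
    \sum_i d (rshift 1 i) * y 0 i ^+ 2 <= (y *m S *m y^T) 0 0.
  rewrite -sym_block_quad//.
  have := Ad (row_mx (- (a^-1 *: (y *m b^T))) y).
  rewrite {1}eA; apply: le_trans.
  rewrite big_ord_recl ler_wpDl ?(mulr_ge0 (ltW (d0 _)) (sqr_ge0 _))//.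
  by apply: ler_sum => i _; rewrite -(row_mxEr (- (a^-1 *: (y *m b^T))) y 0 i) rshift1.
have dS0 (i : 'I_n) : 0 < d (rshift 1 i) by [].
have /andP[lo hi] := IH S _ symS dS0 Sd.
have -> : \det A = a * \det S by rewrite eA sym_block_det.
have S0 : 0 <= \det S by apply: le_trans lo; apply: prodr_ge0 => i _; exact: ltW.
rewrite !big_ord_recl; apply/andP; split.
  apply: (@le_trans _ _ (d 0 * \det S)); last by rewrite ler_wpM2r.
  rewrite ler_wpM2l ?(ltW (d0 _))//; apply: le_trans lo.
  by rewrite le_eqVlt; apply/orP; left; apply/eqP/eq_bigr => i _; rewrite rshift1.
rewrite ler_wpM2l ?(ltW a0)//; apply: (le_trans hi); apply: ler_prod => i _.
rewrite (le_trans (ltW (dS0 i)) (quad_diag_le i dS0 Sd))/=.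
have -> : A (lift ord0 i) (lift ord0 i) = C i i.
  by rewrite /C !mxE !rshift1.
rewrite /S !mxE big_ord1 !mxE lerBlDr lerDl mulr_ge0 ?invr_ge0 ?(ltW a0)//; exact: sqr_ge0.
Qed.

(** * Stable recursions *)

Import Normc.

(** The norm on [R[i]] takes its values in [R[i]]; [normc] is the real-valued form needed for sums
    of squares in [R]. *)
Lemma normr_normc (R : rcfType) (z : R[i]) : `|z| = real_complex R (normc z).
Proof. by case: z. Qed.

Lemma normc_real (R : rcfType) (x : R) : normc (real_complex R x) = `|x|.
Proof. by rewrite /= expr0n addr0 sqrtr_sqr. Qed.

Lemma stable_step (R : realFieldType) (r : R) (a f : nat -> R) n :
  0 <= r -> r < 1 -> (forall t, 0 <= a t) -> (forall t, 0 <= f t) ->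
  (forall t, a t.+1 <= r * (a t + f t.+1)) ->
  (1 - r) * \sum_(1 <= t < n.+1) a t ^+ 2 <=
    a 0%N ^+ 2 + (1 - r)^-1 * \sum_(1 <= t < n.+1) f t ^+ 2.
Proof.
move=> r0 r1 a0 f0 rec.
have s0 : 0 < 1 - r by lra.
(* The additional term [r * a n ^+ 2] lets the induction close: its step becomes a comparison of
   [a n.+1 ^+ 2] with [a n ^+ 2] and [f n.+1 ^+ 2] alone. *)
suff h : (1 - r) * \sum_(1 <= t < n.+1) a t ^+ 2 + r * a n ^+ 2 <=
    r * a 0%N ^+ 2 + (1 - r)^-1 * \sum_(1 <= t < n.+1) f t ^+ 2.
  have : 0 <= r * a n ^+ 2 by rewrite mulr_ge0 ?sqr_ge0.
  have : r * a 0%N ^+ 2 <= a 0%N ^+ 2 by rewrite ler_piMl ?sqr_ge0// ltW.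
  by move: h; lra.
elim: n => [|n IH]; first by rewrite !big_geq// !mulr0 addr0 add0r.
suff h : a n.+1 ^+ 2 <= r * a n ^+ 2 + (1 - r)^-1 * f n.+1 ^+ 2.
  rewrite !(big_nat_recr n.+1)//= !mulrDr -addrA -mulrDl subrK mul1r.
  rewrite addrA; apply: (@le_trans _ _ ((1 - r) * \sum_(1 <= t < n.+1) a t ^+ 2 +
    (r * a n ^+ 2 + (1 - r)^-1 * f n.+1 ^+ 2))); first by rewrite lerD2l.
  by rewrite addrA lerD2r.
apply: (@le_trans _ _ ((r * (a n + f n.+1)) ^+ 2)).
  by rewrite ler_sqr// nnegrE// mulr_ge0// addr_ge0.
(* convexity of the square with weights [r] and [1 - r] *)
have e : r * a n ^+ 2 + (1 - r)^-1 * f n.+1 ^+ 2 - (r * (a n + f n.+1)) ^+ 2 =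
    r * (1 - r) * (a n - r / (1 - r) * f n.+1) ^+ 2 + (1 + r) * f n.+1 ^+ 2.
  by field; rewrite gt_eqF.
have s1 : 0 <= 1 + r by lra.
rewrite -subr_ge0 e addr_ge0//; apply: mulr_ge0; rewrite ?sqr_ge0//.
by rewrite mulr_ge0// ltW.
Qed.

(** With [f] the filtered series, [z * x (t + 1) = x t - f (t + 1)] is a recursion contracting by
    [r = 1 / normc z]. The initial value only enters the additive constant [M]. *)
Lemma stable_root (R : rcfType) (z : R[i]) (x : int -> R[i]) :
  1 < normc z ->
  exists K M : R, [/\ 0 <= K & forall n,
    \sum_(1 <= t < n.+1) normc (x t%:Z) ^+ 2 <=
    K * \sum_(1 <= t < n.+1) normc (lag ('X - z%:P) x t%:Z) ^+ 2 + M].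
Proof.
move=> z1; set r := (normc z)^-1.
have z0 : 0 < normc z by apply: lt_trans z1.
have r0 : 0 <= r by rewrite invr_ge0 ltW.
have r1 : r < 1 by rewrite invf_lt1.
have s0 : 0 < 1 - r by lra.
exists ((1 - r)^-1 * (1 - r)^-1), ((1 - r)^-1 * normc (x 0) ^+ 2).
split=> [|n]; first by rewrite mulr_ge0// invr_ge0 ltW.
have nn (w : R[i]) : 0 <= normc w by case: w => u v; rewrite /= sqrtr_ge0.
have := @stable_step R r (fun t => normc (x t%:Z))
  (fun t => normc (lag ('X - z%:P) x t%:Z)) n r0 r1 (fun=> nn _) (fun=> nn _).
move=> H; rewrite -(ler_pM2l s0) mulrDr !mulrA mulfV ?mul1r ?lt0r_neq0//.
rewrite [leRHS]addrC; apply: H => t.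
rewrite lagD lagX lagN lagC.
have -> : t.+1%:Z - 1 = t%:Z by lia.
rewrite -(ler_pM2l z0) mulrA mulfV ?mul1r ?lt0r_neq0// -normcM.
have e : z * x t.+1 = x t + - (x t - z * x t.+1) by ring.
have nN (w : R[i]) : normc (- w) = normc w by case: w => u v /=; rewrite !sqrrN.
by rewrite [X in normc X <= _]e; apply: (le_trans (le_normcD _ _)); rewrite nN.
Qed.

(** One root at a time: a linear factor is applied to [x], and the induction hypothesis to the
    filtered series. The induction ranges over [x], as each intermediate series adds its own initial
    value to [M]. *)
Lemma stable_roots (R : rcfType) (s : seq R[i]) (x : int -> R[i]) :
  (forall z, z \in s -> 1 < normc z) ->
  exists K M : R, [/\ 0 <= K & forall n,
    \sum_(1 <= t < n.+1) normc (x t%:Z) ^+ 2 <=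
    K * \sum_(1 <= t < n.+1)
          normc (lag (\prod_(z <- s) ('X - z%:P)) x t%:Z) ^+ 2 + M].
Proof.
elim: s x => [|z s IH] x hs.
  exists 1, 0; split=> // n; rewrite big_nil mul1r addr0.
  by under [leRHS]eq_bigr do rewrite -[1]/(1%:P) lagC mul1r.
have [K [M [K0 KM]]] := stable_root x (hs z (mem_head _ _)).
have hs' u : u \in s -> 1 < normc u.
  by move=> us; apply: hs; rewrite in_cons us orbT.
have [K' [M' [K0' KM']]] := IH (lag ('X - z%:P) x) hs'.
exists (K * K'), (K * M' + M); split=> [|n]; first by rewrite mulr_ge0.
rewrite big_cons addrA -mulrA -mulrDr; apply: (le_trans (KM n)).
rewrite lerD2r ler_wpM2l//; apply: (le_trans (KM' n)).
rewrite lerD2r ler_wpM2l// le_eqVlt; apply/orP; left; apply/eqP.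
by apply: eq_bigr => t _; rewrite mulrC lagM.
Qed.

(** The linear factors of the real polynomial [a] are complex, so the path is embedded in [R[i]];
    [K] absorbs the leading coefficient. *)
Lemma stable_lag (R : rcfType) (a : {poly R}) (x : int -> R) :
  a != 0 ->
  (forall z : R[i], root (map_poly (real_complex R) a) z -> 1 < `|z|) ->
  exists K M : R, 0 <= K /\ forall n,
    \sum_(1 <= t < n.+1) x t%:Z ^+ 2 <=
    K * \sum_(1 <= t < n.+1) lag a x t%:Z ^+ 2 + M.
Proof.
move=> a0 roots; pose b := map_poly (real_complex R) a.
have [s eb] := closed_field_poly_normal b.
have b0 : b != 0 by rewrite map_poly_eq0.
have l0 : lead_coef b != 0 by rewrite lead_coef_eq0.
have hs z : z \in s -> 1 < normc z.
  move=> zs; rewrite -ltcR -normr_normc; apply: roots.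
  by rewrite -/b eb rootZ// root_prod_XsubC.
have [K [M [K0 KM]]] := stable_roots (real_complex R \o x) hs.
exists (K * normc (lead_coef b)^-1 ^+ 2), M; split=> [|n].
  by rewrite mulr_ge0 ?sqr_ge0.
have e t : normc ((real_complex R \o x) t) ^+ 2 = x t ^+ 2.
  by rewrite [normc _](normc_real (x t)) -normrX ger0_norm ?sqr_ge0.
rewrite -(eq_bigr _ (fun (t : nat) _ => e t)); apply: (le_trans (KM n)).
rewrite lerD2r -mulrA ler_wpM2l// mulr_sumr.
apply: ler_sum => t _; rewrite -exprMn.
suff -> : normc (lag (\prod_(z <- s) ('X - z%:P)) (real_complex R \o x) t) =
    normc (lead_coef b)^-1 * `|lag a x t|.
  by rewrite !exprMn -normrX (ger0_norm (sqr_ge0 _)).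
rewrite -normc_real -(lag_map (real_complex R)) -/b {2}eb lagZ -normcM mulrA.
by rewrite mulVf// mul1r.
Qed.

(** * Polynomial orders of growth *)

Section Order.
Variable R : realType.
Implicit Types (a b : nat -> R) (e C : R).

(** Growth exponent at most [e], with a slack of every power [n ^ dl]. The slack absorbs constant
    factors and is invisible in the limit of [ln (a n) / ln n]. *)
Definition poly_ub e a :=
  forall dl : R, 0 < dl -> \forall n \near \oo, a n <= n%:R `^ (e + dl).

Definition poly_lb e a :=
  forall dl : R, 0 < dl -> \forall n \near \oo, n%:R `^ (e - dl) <= a n.

Lemma near_ge_powR C e : 0 < e -> \forall n \near \oo, C <= n%:R `^ e.
Proof.
move=> e0; near=> n.
have C1 : 0 <= `|C| `^ e^-1 by exact: powR_ge0.
have : `|C| `^ e^-1 <= n%:R by near: n; exact: nbhs_infty_ger.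
move=> /(ge0_ler_powR (ltW e0)); rewrite !nnegrE C1 ler0n => /(_ isT isT).
rewrite -powRrM mulVf ?gt_eqF// powRr1//; apply: le_trans; exact: ler_norm.
Unshelve. all: by end_near. Qed.

Lemma natr_powRD (n : nat) e e' : (0 < n)%N ->
  (n%:R : R) `^ (e + e') = n%:R `^ e * n%:R `^ e'.
Proof. by move=> n0; rewrite powRD// pnatr_eq0 -lt0n n0 implybT. Qed.

Lemma natr_powR_le (n : nat) e e' : (0 < n)%N -> e <= e' ->
  (n%:R : R) `^ e <= n%:R `^ e'.
Proof. by move=> n0 ee; apply: ler_powR => //; rewrite ler1n. Qed.

(** Half of [dl] goes to the bound on [a], the other half absorbs [C + |M|]. As [0 <= e], the power
    is at least [1], so the additive constant can be treated as a factor. *)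
Lemma poly_ub_le e C M a b : 0 <= C -> 0 <= e ->
  (\forall n \near \oo, b n <= C * a n + M) -> poly_ub e a -> poly_ub e b.
Proof.
move=> C0 e0 ba ua dl dl0; have d2 : 0 < dl / 2 by lra.
near=> n; have n0 : (0 < n)%N by near: n; exact: nbhs_infty_gt.
have h1 : a n <= n%:R `^ (e + dl / 2) by near: n; exact: ua.
have h2 : C + `|M| <= n%:R `^ (dl / 2) by near: n; exact: near_ge_powR.
have h3 : b n <= C * a n + M by near: n.
have -> : e + dl = (e + dl / 2) + dl / 2 by lra.
rewrite natr_powRD//; apply: (le_trans h3).
have g1 : 1 <= n%:R `^ (e + dl / 2) :> R.
  have := natr_powR_le n0 (addr_ge0 e0 (ltW d2)).
  by rewrite powRr0.
apply: (@le_trans _ _ ((C + `|M|) * n%:R `^ (e + dl / 2))).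
  rewrite mulrDl lerD ?ler_wpM2l//; apply: (le_trans (ler_norm _)).
  by rewrite ler_peMr.
by rewrite mulrC ler_wpM2l// powR_ge0.
Unshelve. all: by end_near. Qed.

Lemma poly_ubD e a b : 0 <= e -> poly_ub e a -> poly_ub e b ->
  poly_ub e (fun n => a n + b n).
Proof.
move=> e0 ua ub; suff : poly_ub e (fun n => Num.max (a n) (b n)).
  apply: (@poly_ub_le _ 2 0) => //; near=> n.
  by rewrite addr0 mulr_natl mulr2n lerD// le_max lexx ?orbT.
move=> dl dl0; near=> n; rewrite ge_max; apply/andP; split; near: n.
  exact: ua.
exact: ub.
Unshelve. all: by end_near. Qed.

Lemma poly_ub_id : poly_ub 1 (fun n => n%:R).
Proof.
move=> dl dl0; near=> n.
have n0 : (0 < n)%N by near: n; exact: nbhs_infty_gt.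
rewrite -[leLHS]powRr1// natr_powR_le//; lra.
Unshelve. all: by end_near. Qed.

Lemma poly_ub_weak e e' a : e <= e' -> poly_ub e a -> poly_ub e' a.
Proof.
move=> ee ua dl dl0; near=> n.
have n0 : (0 < n)%N by near: n; exact: nbhs_infty_gt.
apply: (@le_trans _ _ (n%:R `^ (e + dl))); first by near: n; exact: ua.
by rewrite natr_powR_le// lerD2r.
Unshelve. all: by end_near. Qed.

Lemma poly_lb_le e c C a b : 0 < c -> 1 < e ->
  (\forall n \near \oo, c * a n - C * n%:R <= b n) -> poly_lb e a ->
  poly_lb e b.
Proof.
move=> c0 e1 ab la dl' dl'0.
(* A smaller [dl'] gives a stronger claim; below [e - 1] the power [n ^ (e - dl')] dominates the
   linear error. *)
wlog dle : dl' dl'0 / dl' < e - 1.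
  move=> H; have [h|h] := ltP dl' (e - 1); first exact: H.
  have g0 : 0 < (e - 1) / 2 by lra.
  have g1 : (e - 1) / 2 < e - 1 by lra.
  have [N _ HN] := H _ g0 g1.
  exists N.+1 => // n /= nN; apply: le_trans (HN _ (ltnW nN)).
  by rewrite natr_powR_le//; [exact: leq_ltn_trans nN|lra].
pose dl := dl' / 2; have dl0 : 0 < dl by rewrite /dl; lra.
near=> n.
have n0 : (0 < n)%N by near: n; exact: nbhs_infty_gt.
have h1 : n%:R `^ (e - dl) <= a n by near: n; exact: la.
have h2 : (1 + `|C|) / c <= n%:R `^ dl by near: n; exact: near_ge_powR.
have h3 : c * a n - C * n%:R <= b n by near: n.
apply: le_trans h3.
have h4 : n%:R `^ (e - dl') * ((1 + `|C|) / c) <= a n.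
  apply: le_trans h1; rewrite (_ : e - dl = e - dl' + dl); last by rewrite /dl; lra.
  by rewrite (natr_powRD (e - dl') dl n0) ler_wpM2l// powR_ge0.
have h5 : n%:R <= n%:R `^ (e - dl') :> R.
  by rewrite -[leLHS]powRr1// natr_powR_le//; lra.
have h6 : n%:R `^ (e - dl') * (1 + `|C|) <= c * a n.
  by rewrite [leRHS]mulrC -ler_pdivrMr// -mulrA.
have h7 : C * n%:R <= `|C| * n%:R `^ (e - dl').
  by rewrite (le_trans (ler_wpM2r _ (ler_norm C)))// ler_wpM2l.
by move: h6 h7; lra.
Unshelve. all: by end_near. Qed.

Lemma poly_order_ln_cvg e (D : nat -> R) : poly_ub e D -> poly_lb e D ->
  (fun n : nat => (ln n%:R)^-1 * ln (D n)) @ \oo --> e.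
Proof.
move=> uD lD; apply/cvgrPdist_le => dl dl0; near=> n.
have n1 : (1 < n)%N by near: n; exact: nbhs_infty_gt.
have n0 : (0 < n)%N by apply: ltn_trans n1.
have l0 : 0 < ln n%:R :> R by rewrite ln_gt0// ltr1n.
have h1 : D n <= n%:R `^ (e + dl) by near: n; exact: uD.
have h2 : n%:R `^ (e - dl) <= D n by near: n; exact: lD.
have p0 x : 0 < n%:R `^ x :> R by rewrite powR_gt0// ltr0n.
(* The lower bound also ensures that [ln (D n)] is a genuine logarithm and not a default value. *)
have D0 : 0 < D n by apply: lt_le_trans h2.
have g1 : (ln n%:R)^-1 * ln (D n) <= e + dl.
  by rewrite mulrC ler_pdivrMr// -ln_powR ler_ln// posrE.
have g2 : e - dl <= (ln n%:R)^-1 * ln (D n).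
  by rewrite mulrC ler_pdivlMr// -ln_powR ler_ln// posrE.
by rewrite ler_distlC; apply/andP; split; lra.
Unshelve. all: by end_near. Qed.

End Order.

(** * The Gram determinant along one path *)

Section UnitRoot.
Variable R : realType.
Variables (th : R) (u E : int -> R).
Hypothesis th2 : th * th = 1.
Hypothesis uE : forall t, u t = th * u (t - 1) + E t.

(** [th ^+ t * u t] is a random walk with increments [th ^+ s * E s], and squaring removes the
    sign. *)
Lemma unit_root_path (t : nat) :
  u t%:Z ^+ 2 = (u 0 + \sum_(1 <= s < t.+1) th ^+ s * E s%:Z) ^+ 2.
Proof.
have -> : u t%:Z = th ^+ t * (u 0 + \sum_(1 <= s < t.+1) th ^+ s * E s%:Z).
  elim: t => [|t IH]; first by rewrite big_geq// expr0 mul1r addr0.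
  rewrite uE (_ : t.+1%:Z - 1 = t%:Z); last by lia.
  rewrite IH (big_nat_recr t.+1)//= addrA [in RHS]mulrDr mulrA -exprS; congr (_ + _).
  by rewrite mulrA -expr2 -exprM mulnC exprM expr2 th2 expr1n mul1r.
by rewrite exprMn -exprM mulnC exprM expr2 th2 expr1n mul1r.
Qed.

(** Run the recursion backwards: [th] is its own inverse, so each step back multiplies by [th] and
    costs one noise term. *)
Lemma unit_root_lag_diff (t : int) (i : nat) :
  `|u (t - i%:Z) - th ^+ i * u t| <= \sum_(j < i) `|E (t - j%:Z)|.
Proof.
have thN : `|th| = 1.
  by apply/eqP; rewrite -(@pexpr_eq1 _ _ 2)// -normrX expr2 th2 normr1.
elim: i => [|i IH]; first by rewrite subr0 expr0 mul1r subrr normr0 big_ord0.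
rewrite big_ord_recr /=.
have -> : u (t - i.+1%:Z) - th ^+ i.+1 * u t =
    th * (u (t - i%:Z) - th ^+ i * u t - E (t - i%:Z)).
  have -> : t - i.+1%:Z = t - i%:Z - 1 by lia.
  have -> : E (t - i%:Z) = u (t - i%:Z) - th * u (t - i%:Z - 1).
    by rewrite [u (t - i%:Z)]uE addrAC subrr add0r.
  rewrite -[u (_ - 1) in LHS]mul1r -th2 exprS; ring.
rewrite normrM thN mul1r (le_trans (ler_normB _ _))// lerD2r.
exact: IH.
Qed.

(** Over a window of length [p], [u] equals [th ^+ i * u t] up to noise, so [lag c u t] equals
    [c.[th] * u t] up to noise. This is how the value of [c] at a unit root is controlled by a
    filtered series. *)
Lemma unit_root_lag_le p (c : {poly R}) (t : int) : (size c <= p)%N ->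
  c.[th] ^+ 2 * u t ^+ 2 <= 2 * lag c u t ^+ 2 +
    2 * p%:R ^+ 2 * (\sum_(i < p) c`_i ^+ 2) * \sum_(j < p) E (t - j%:Z) ^+ 2.
Proof.
move=> sc; pose v i := u (t - i%:Z) - th ^+ i * u t.
have e : lag c u t = c.[th] * u t + \sum_(i < p) c`_i * v i.
  rewrite (lagE _ _ sc) (horner_coef_wide _ sc) mulr_suml -big_split /=.
  by apply: eq_bigr => i _; rewrite /v; ring.
have h : (\sum_(i < p) c`_i * v i) ^+ 2 <=
    p%:R ^+ 2 * (\sum_(i < p) c`_i ^+ 2) * \sum_(j < p) E (t - j%:Z) ^+ 2.
  apply: (le_trans (sum_cauchy_schwarz _ _)).
  rewrite [X in _ <= X * _]mulrC -mulrA ler_wpM2l//.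
    by apply: sumr_ge0 => i _; exact: sqr_ge0.
  rewrite expr2 -mulrA.
  have -> : forall x : R, p%:R * x = \sum_(i < p) x.
    by move=> x; rewrite sumr_const card_ord mulr_natl.
  apply: ler_sum => i _.
  apply: (@le_trans _ _ ((\sum_(j < p) `|E (t - j%:Z)|) ^+ 2)).
    rewrite -real_normK ?num_real// ler_sqr ?nnegrE ?sumr_ge0//.
    apply: (le_trans (unit_root_lag_diff _ _)).
    rewrite (big_ord_widen _ (fun j => `|E (t - j%:Z)|) (ltnW (ltn_ord i))).
    by rewrite big_mkcond /=; apply: ler_sum => j _; case: ifP.
  apply: (le_trans (sqr_sum_le _)).
  by under eq_bigr do rewrite real_normK ?num_real//.
rewrite -exprMn (_ : c.[th] * u t = lag c u t - \sum_(i < p) c`_i * v i); last first.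
  by rewrite e addrK.
set w := \sum_(i < p) c`_i * v i in h *.
have : 0 <= (lag c u t + w) ^+ 2 by exact: sqr_ge0.
have -> : 2 * p%:R ^+ 2 * (\sum_(i < p) c`_i ^+ 2) * \sum_(j < p) E (t - j%:Z) ^+ 2
  = 2 * (p%:R ^+ 2 * (\sum_(i < p) c`_i ^+ 2) * \sum_(j < p) E (t - j%:Z) ^+ 2).
  by rewrite !mulrA.
move: h; set B := _ * _ * _; rewrite sqrrB sqrrD; lra.
Qed.

Let S (t : nat) := \sum_(1 <= s < t.+1) th ^+ s * E s%:Z.

Lemma unit_root_ub :
  poly_ub 2 (fun n => \sum_(1 <= t < n.+1) S t ^+ 2) ->
  poly_ub 2 (fun n => \sum_(1 <= t < n.+1) u t%:Z ^+ 2).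
Proof.
move=> hS; have hu0 : poly_ub 2 (fun n => n%:R : R).
  by apply: poly_ub_weak (@poly_ub_id R); lra.
have C0 : 0 <= 2 + 2 * u 0 ^+ 2 by rewrite addr_ge0// mulr_ge0// sqr_ge0.
apply: (@poly_ub_le _ 2 (2 + 2 * u 0 ^+ 2) 0 _ _ C0 _ _ (poly_ubD _ hS hu0)) => //.
near=> n; rewrite addr0.
apply: (@le_trans _ _ (\sum_(1 <= t < n.+1) (2 * S t ^+ 2 + 2 * u 0 ^+ 2))).
  apply: ler_sum => t _; rewrite unit_root_path -/(S t).
  have := sqr_ge0 (u 0 - S t); move: (u 0) (S t) => a b; nra.
rewrite big_split /= -mulr_sumr sumr_const_nat subn1 /= -mulr_natr.
have : 0 <= \sum_(1 <= t < n.+1) S t ^+ 2.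
  by apply: sumr_ge0 => t _; exact: sqr_ge0.
have := sqr_ge0 (u 0); have : 0 <= n%:R :> R by [].
set x := u 0 ^+ 2; set y := \sum_(_ <= _ < _) _; set N := n%:R.
by move=> N0 x0 y0; have := mulr_ge0 x0 y0; nra.
Unshelve. all: by end_near. Qed.

(** The first [p] terms are given up to leave room for lags. Their sum and the initial value cost a
    multiple of [n], of lower order than [n ^ 2]. *)
Lemma unit_root_lb p :
  poly_lb 2 (fun n => \sum_(1 <= t < n.+1) S t ^+ 2) ->
  poly_lb 2 (fun n => \sum_(p.+1 <= t < n.+1) u t%:Z ^+ 2).
Proof.
move=> hS; pose M := \sum_(1 <= t < p.+1) u t%:Z ^+ 2.
apply: (@poly_lb_le _ 2 (1 / 2) (u 0 ^+ 2 + M) _ _ _ _ _ hS); [lra|lra|].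
near=> n.
have pn : (p < n)%N by near: n; exact: nbhs_infty_gt.
have M0 : 0 <= M by apply: sumr_ge0 => t _; exact: sqr_ge0.
have -> : \sum_(p.+1 <= t < n.+1) u t%:Z ^+ 2 =
    \sum_(1 <= t < n.+1) u t%:Z ^+ 2 - M.
  by rewrite [in RHS](@big_cat_nat _ _ _ p.+1)//= ?addrA -/M; [ring|exact: ltnW].
have : \sum_(1 <= t < n.+1) (1 / 2 * S t ^+ 2 - u 0 ^+ 2) <=
    \sum_(1 <= t < n.+1) u t%:Z ^+ 2.
  apply: ler_sum => t _; rewrite unit_root_path -/(S t).
  have := sqr_ge0 (2 * u 0 + S t); move: (u 0) (S t) => a b; nra.
rewrite sumrB -mulr_sumr sumr_const_nat subn1 /= -mulr_natr.
have n1 : 1 <= n%:R :> R by rewrite ler1n; lia.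
have : M <= M * n%:R by rewrite ler_peMr.
rewrite mulrDl; lra.
Unshelve. all: by end_near. Qed.

End UnitRoot.

(* Written in the basis [1, X, X^2 - 1, X^3 - X, ...], a polynomial takes at
   [1] and [-1] values that only involve its first two coordinates. *)
Definition lag_basis (R : nzRingType) (i : nat) : {poly R} :=
  if (i < 2)%N then 'X^i else 'X^i - 'X^(i - 2).

Lemma coef_lag_basis (R : nzRingType) (i j : nat) : (i <= j)%N ->
  (lag_basis R i)`_j = (i == j)%:R.
Proof.
rewrite /lag_basis => ij; case: ifP => i2; first by rewrite coefXn eq_sym.
rewrite coefB !coefXn eq_sym (_ : (j == (i - 2))%N = false) ?subr0//.
by apply/eqP; lia.
Qed.

Lemma size_lag_basis (R : nzRingType) (i : nat) : (size (lag_basis R i) <= i.+1)%N.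
Proof.
by apply/leq_sizeP => j ij; rewrite coef_lag_basis ?(ltnW ij)// ltn_eqF.
Qed.

Definition lag_basis_mx (R : nzRingType) (p : nat) : 'M[R]_p :=
  \matrix_(i, j) (lag_basis R i)`_j.

Lemma det_lag_basis_mx (R : comNzRingType) p : \det (lag_basis_mx R p) = 1.
Proof.
rewrite det_trig; first by rewrite big1// => i _; rewrite mxE coef_lag_basis ?eqxx.
by apply/is_trig_mxP => i j ij; rewrite mxE coef_lag_basis ?(ltnW ij)// ltn_eqF.
Qed.

Definition lag_comb (R : comNzRingType) p (x : 'rV[R]_p) : {poly R} :=
  \sum_i x 0 i *: lag_basis R i.

Lemma coef_lag_comb (R : comNzRingType) p (x : 'rV[R]_p) (j : 'I_p) :
  (lag_comb x)`_j = (x *m lag_basis_mx R p) 0 j.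
Proof.
by rewrite coef_sum mxE; apply: eq_bigr => i _; rewrite coefZ !mxE.
Qed.

Lemma size_lag_comb (R : comNzRingType) p (x : 'rV[R]_p) :
  (size (lag_comb x) <= p)%N.
Proof.
apply: (leq_trans (size_sum _ _ _)); apply/bigmax_leqP => i _.
by rewrite (leq_trans (size_scale_leq _ _))// (leq_trans (size_lag_basis _ _)).
Qed.

Lemma lag_comb_sqr_ge (R : realFieldType) p :
  exists2 K : R, 0 <= K & forall x : 'rV[R]_p,
    \sum_i x 0 i ^+ 2 <= K * \sum_(j < p) (lag_comb x)`_j ^+ 2.
Proof.
have [K K0 KP] := row_mulmx_sqr_le (invmx (lag_basis_mx R p)).
exists K => // x; have := KP (x *m lag_basis_mx R p).
rewrite mulmxK ?unitmxE ?det_lag_basis_mx ?unitr1//.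
by under [in X in _ <= X -> _]eq_bigr do rewrite -coef_lag_comb.
Qed.

Lemma horner_lag_comb (R : comNzRingType) q (x : 'rV[R]_q.+2) (th : R) :
  th * th = 1 -> (lag_comb x).[th] = x 0 0 + th * x 0 1.
Proof.
move=> th2; rewrite /lag_comb horner_sum !big_ord_recl big1 ?addr0.
  rewrite !hornerZ /lag_basis /= hornerXn expr0 mulr1; congr (_ + _).
  rewrite hornerXn expr1 mulrC; congr (_ * x 0 _); exact: val_inj.
move=> i _; rewrite hornerZ /lag_basis /= /bump /= !add1n subn2 /=.
by rewrite hornerD hornerN !hornerXn !exprS mulrA th2 mul1r subrr mulr0.
Qed.

(** * The Gram matrix in the adapted basis *)

Section Gram.
Variables (R : realType) (p : nat) (y : int -> R).

(** A congruence by a unitriangular matrix: the determinant is kept, while the different growth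
    rates are separated along the diagonal. *)
Definition basis_gram n : 'M[R]_p :=
  lag_basis_mx R p *m lag_gram p y n *m (lag_basis_mx R p)^T.

Lemma basis_gramE n : basis_gram n = \sum_(1 <= t < n.+1)
  (\col_(i < p) lag (lag_basis R i) y t%:Z) *m
  (\col_(i < p) lag (lag_basis R i) y t%:Z)^T.
Proof.
rewrite /basis_gram /lag_gram mulmx_sumr mulmx_suml; apply: eq_bigr => t _.
have -> : \col_(i < p) lag (lag_basis R i) y t%:Z =
    lag_basis_mx R p *m lag_vector p y t.
  apply/colP => i; rewrite !mxE (@lagE _ p) ?(leq_trans (size_lag_basis _ _))//.
  by apply: eq_bigr => j _; rewrite !mxE.
by rewrite trmx_mul !mulmxA.
Qed.

Lemma det_basis_gram n : \det (basis_gram n) = \det (lag_gram p y n).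
Proof. by rewrite !det_mulmx det_tr det_lag_basis_mx mulr1 mul1r. Qed.

Lemma tr_basis_gram n : (basis_gram n)^T = basis_gram n.
Proof.
rewrite basis_gramE raddf_sum; apply: eq_bigr => t _.
by rewrite /= trmx_mul trmxK.
Qed.

Lemma basis_gram_diag n i :
  basis_gram n i i = \sum_(1 <= t < n.+1) lag (lag_basis R i) y t%:Z ^+ 2.
Proof.
rewrite basis_gramE summxE; apply: eq_bigr => t _.
by rewrite mxE big_ord1 !mxE expr2.
Qed.

Lemma basis_gram_quad n (x : 'rV[R]_p) : (x *m basis_gram n *m x^T) 0 0 =
  \sum_(1 <= t < n.+1) lag (lag_comb x) y t%:Z ^+ 2.
Proof.
rewrite basis_gramE mulmx_sumr mulmx_suml summxE; apply: eq_bigr => t _.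
set v := \col_i _.
have e : (x *m v) 0 0 = lag (lag_comb x) y t%:Z.
  by rewrite lag_sum mxE; apply: eq_bigr => i _; rewrite lagZ !mxE.
have e' : (v^T *m x^T) 0 0 = (x *m v) 0 0.
  by rewrite -trmx_mul mxE.
by rewrite mulmxA -mulmxA mxE big_ord1 e' e expr2.
Qed.

End Gram.

(** The first [i] terms, which reach back to times [<= 0], form a constant; the others are among the
    unshifted terms. *)
Lemma shift_sqr_ub (R : realType) (x : int -> R) (i : nat) e : 0 <= e ->
  poly_ub e (fun n => \sum_(1 <= t < n.+1) x t%:Z ^+ 2) ->
  poly_ub e (fun n => \sum_(1 <= t < n.+1) x (t%:Z - i%:Z) ^+ 2).
Proof.
move=> e0; apply: (@poly_ub_le _ _ 1 (\sum_(1 <= t < i.+1) x (t%:Z - i%:Z) ^+ 2)) => //.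
near=> n.
have ni : (i < n)%N by near: n; exact: nbhs_infty_gt.
rewrite mul1r (@big_cat_nat _ _ _ i.+1)//=; last exact: ltnW.
rewrite addrC lerD2r.
by apply: (@sum_shift_le _ (fun t => x t ^+ 2)) => // t; exact: sqr_ge0.
Unshelve. all: by end_near. Qed.

(** The boolean selects the unit root, [false] for [1] and [true] for [-1]; this is the random walk
    attached to it. *)
Definition sgn_sum (R : realType) (b : bool) (E : int -> R) (t : nat) : R :=
  \sum_(1 <= s < t.+1) ((-1) ^+ b) ^+ s * E s%:Z.

(** * Growth of the Gram determinant *)

Section GramOrder.
Variables (R : realType) (q : nat) (Psi : {poly R}) (y : int -> R).
Local Notation p := q.+2.
Hypothesis size_Psi : size Psi = q.+1.
Hypothesis Psi_roots :
  forall z : R[i], root (map_poly (real_complex R) Psi) z -> 1 < `|z|.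

Let phi : {poly R} := (1 - 'X) * (1 + 'X) * Psi.
Let E := lag phi y.
Let th (b : bool) : R := (-1) ^+ b.
(** [phi] with the factor [1 - th b *: 'X] removed, so that [u b] solves the first order recursion
    with root [th b]. *)
Let half (b : bool) : {poly R} := (1 + (th b) *: 'X) * Psi.
Let u (b : bool) := lag (half b) y.

Hypothesis E_ub : poly_ub 1 (fun n => \sum_(1 <= t < n.+1) E t%:Z ^+ 2).
Hypothesis S_ub : forall b,
  poly_ub 2 (fun n => \sum_(1 <= t < n.+1) sgn_sum b E t ^+ 2).
Hypothesis S_lb : forall b,
  poly_lb 2 (fun n => \sum_(1 <= t < n.+1) sgn_sum b E t ^+ 2).
(** Persistent excitation. The quantifier on [c] stands inside the eventual statement, so the bound
    is uniform in the coefficients. *)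
Hypothesis E_excited : exists2 k : R, 0 < k & \forall n \near \oo,
  forall c : 'I_p -> R, k * n%:R * (\sum_i c i ^+ 2) <=
    \sum_(p.+1 <= t < n.+1) (\sum_i c i * E (t%:Z - i%:Z)) ^+ 2.

Let th2 b : th b * th b = 1.
Proof. by rewrite /th; case: b; rewrite ?expr0 ?expr1 ?mulrNN mul1r. Qed.

Let u_rec b t : u b t = th b * u b (t - 1) + E t.
Proof.
suff e : phi = half b - th b *: (half b * 'X).
  by rewrite /E e lagD lagN lagZ lagMX addrC subrK.
have T2 : (th b)%:P * (th b)%:P = 1 by rewrite -polyCM th2.
rewrite /phi /half -!mul_polyC.
transitivity ((1 - (th b)%:P * (th b)%:P * 'X^2) * Psi); last by ring.
by rewrite T2; ring.
Qed.

Let Psi0 : Psi != 0.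
Proof. by rewrite -size_poly_eq0 size_Psi. Qed.

Let size_phi : (size phi <= p.+1)%N.
Proof.
have s : size ((1 - 'X) * (1 + 'X) : {poly R}) = 3.
  have -> : (1 - 'X) * (1 + 'X) = - ('X^2 - 1%:P) :> {poly R} by rewrite expr2; ring.
  by rewrite size_polyN size_XnsubC.
by rewrite (leq_trans (size_polyMleq _ _))// s size_Psi.
Qed.

Let size_half b : (size (half b) <= p.+1)%N.
Proof.
have s : (size (1 + (th b) *: 'X : {poly R})%R <= 2)%N.
  rewrite (leq_trans (size_polyD _ _))// geq_max size_poly1 /=.
  by rewrite (leq_trans (size_scale_leq _ _))// size_polyX.
by rewrite (leq_trans (size_polyMleq _ _))// size_Psi; lia.
Qed.

(** Growth exponents of the diagonal entries: the two coordinates that see the unit roots have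
    exponent [2]. The exponents add up to [p + 2]. *)
Let ex (i : 'I_p) : R := if (i < 2)%N then 2 else 1.

Let y_ub : poly_ub 2 (fun n => \sum_(1 <= t < n.+1) y t%:Z ^+ 2).
Proof.
have [K [M [K0 KM]]] := stable_lag y Psi0 Psi_roots.
have hu b := unit_root_ub (th2 b) (u_rec b) (S_ub b).
apply: (@poly_ub_le _ _ (K / 2) M) (poly_ubD _ (hu true) (hu false)) => //.
  by rewrite mulr_ge0// invr_ge0.
near=> n; apply: (le_trans (KM n)); rewrite lerD2r -mulrA ler_wpM2l//.
rewrite -big_split mulr_sumr /=; apply: ler_sum => t _.
(* The two halves add up to [2 * Psi], because [(1 - 'X) + (1 + 'X) = 2]. *)
have -> : lag Psi y t%:Z = (u true t%:Z + u false t%:Z) / 2.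
  have -> : Psi = 2^-1 *: (half true + half false).
    rewrite /half /th expr0 expr1 -mulrDl scaleN1r scale1r.
    have -> : 1 - 'X + (1 + 'X) = 2%:R :> {poly R} by ring.
    by rewrite mulr_natl -(scaler_nat 2 Psi) scalerA mulVf ?scale1r// pnatr_eq0.
  by rewrite lagZ lagD mulrC.
have := sqr_ge0 (u true t%:Z - u false t%:Z); nra.
Unshelve. all: by end_near. Qed.

Let w_ub : poly_ub 1 (fun n => \sum_(1 <= t < n.+1) lag (1 - 'X^2) y t%:Z ^+ 2).
Proof.
have [K [M [K0 KM]]] := stable_lag (lag (1 - 'X^2) y) Psi0 Psi_roots.
apply: (@poly_ub_le _ _ K M) E_ub => //; near=> n.
apply: (le_trans (KM n)); rewrite lerD2r ler_wpM2l//; apply: ler_sum => t _.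
rewrite -lagM (_ : Psi * _ = phi)// /phi expr2; ring.
Unshelve. all: by end_near. Qed.

(** The first two entries are sums of squares of [y], up to a lag. For [i >= 2] the basis polynomial
    contains the factor [1 - 'X^2], which cancels both unit roots. *)
Let diag_ub i : poly_ub (ex i) (fun n => basis_gram p y n i i).
Proof.
have [i2|i2] := ltnP i 2.
  apply: (@poly_ub_le _ _ 1 0 (fun n => \sum_(1 <= t < n.+1) y (t%:Z - i%:Z) ^+ 2)).
  - by [].
  - by rewrite /ex i2.
  - near=> n; rewrite basis_gram_diag mul1r addr0 /lag_basis i2.
    by under eq_bigr do rewrite lagXn.
  - by rewrite /ex i2; exact: shift_sqr_ub.
apply: (@poly_ub_le _ _ 1 0 (fun n => \sum_(1 <= t < n.+1)
    lag (1 - 'X^2) y (t%:Z - (i - 2)%N%:Z) ^+ 2)).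
- by [].
- by rewrite /ex ltnNge i2.
- near=> n; rewrite basis_gram_diag mul1r addr0 /lag_basis ltnNge i2 /=.
  rewrite le_eqVlt; apply/orP; left; apply/eqP; apply: eq_bigr => t _.
  have -> : 'X^i - 'X^(i - 2) = - ('X^(i - 2) * (1 - 'X^2)) :> {poly R}.
    by rewrite mulrBr mulr1 -exprD subnK// opprB.
  by rewrite lagN lagM lagXn sqrrN.
- by rewrite /ex ltnNge i2; exact: shift_sqr_ub.
Unshelve. all: by end_near. Qed.

Let quad_lb dl : 0 < dl -> \forall n \near \oo, forall x : 'rV[R]_p,
  \sum_i n%:R `^ (ex i - dl) * x 0 i ^+ 2 <= (x *m basis_gram p y n *m x^T) 0 0.
Proof.
(* One [eta] is spent on the lower bound for [u], one on the upper bound for the noise, and one on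
   absorbing the constant [C]. *)
move=> dl0; pose eta := dl / 3; have eta0 : 0 < eta by rewrite /eta; lra.
have [k k0 Ek] := E_excited.
have [Kp Kp0 KpP] := @lag_comb_sqr_ge R p.
have [K K0 KP] := lag_sqr_sum_le size_phi.
have [K1 K10 K1P] := lag_sqr_sum_le (size_half true).
have [K2 K20 K2P] := lag_sqr_sum_le (size_half false).
have u_lb b := @unit_root_lb _ _ _ _ (th2 b) (u_rec b) p (S_lb b).
(* The sum of the constants in the two final bounds [x01] and [hx]. *)
pose C := 2 * (K1 + K2) + 2 * p%:R ^+ 3 * (K / k) + Kp * (K / k).
have KK0 : 0 <= K / k by rewrite divr_ge0// ltW.
near=> n => x.
have n0 : (0 < n)%N by near: n; exact: nbhs_infty_gt.
have n0' : 0 < n%:R :> R by rewrite ltr0n.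
have U_lb b : n%:R `^ (2 - eta) <= \sum_(p.+1 <= t < n.+1) u b t%:Z ^+ 2.
  by move: b; near: n; near=> n => -[]; near: n; exact: u_lb.
have V_ub : \sum_(1 <= t < n.+1) E t%:Z ^+ 2 <= n%:R `^ (1 + eta).
  by near: n; exact: E_ub.
have C_ub : C <= n%:R `^ eta by near: n; exact: near_ge_powR.
have En : forall c : 'I_p -> R, k * n%:R * (\sum_i c i ^+ 2) <=
    \sum_(p.+1 <= t < n.+1) (\sum_i c i * E (t%:Z - i%:Z)) ^+ 2 by near: n.
rewrite basis_gram_quad; set c := lag_comb x.
set Q := \sum_(_ <= _ < _) _.
have Q0 : 0 <= Q by apply: sumr_ge0 => t _; exact: sqr_ge0.
set V := \sum_(1 <= t < n.+1) E t%:Z ^+ 2 in V_ub.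
have V0 : 0 <= V by apply: sumr_ge0 => t _; exact: sqr_ge0.
pose c2 := \sum_(i < p) c`_i ^+ 2.
have c20 : 0 <= c2 by apply: sumr_ge0 => t _; exact: sqr_ge0.
have sc : (size c <= p)%N := size_lag_comb x.
(* Lag polynomials commute, so the noise filtered by [c] is [phi] applied to [lag c y], of square
   sum at most [K * Q]. Excitation turns this into a bound on the coefficients. *)
have hc : n%:R * c2 <= K / k * Q.
  rewrite mulrAC ler_pdivlMr// mulrC mulrA.
  apply: (le_trans (En _)); apply: le_trans (KP (lag c y) n).
  rewrite le_eqVlt; apply/orP; left; apply/eqP; apply: eq_bigr => t _.
  by rewrite -(lagE _ _ sc) -!lagM mulrC.
have hV : \sum_(p.+1 <= t < n.+1) \sum_(j < p) E (t%:Z - j%:Z) ^+ 2 <= p%:R * V.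
  rewrite exchange_big /= mulr_natl -[X in _ *+ X]card_ord -sumr_const.
  apply: ler_sum => j _; apply: (@sum_shift_le _ (fun t => E t ^+ 2)).
    exact: ltnW.
  by move=> t; exact: sqr_ge0.
(* Likewise [lag c (u b)] is [half b] applied to [lag c y], which [Q] controls; the window errors
   contribute [c2 * V]. *)
have hu b : c.[th b] ^+ 2 * n%:R `^ (2 - eta) <=
    2 * (K1 + K2) * Q + 2 * p%:R ^+ 3 * c2 * V.
  apply: (@le_trans _ _ (c.[th b] ^+ 2 * \sum_(p.+1 <= t < n.+1) u b t%:Z ^+ 2)).
    by rewrite ler_wpM2l ?sqr_ge0.
  rewrite mulr_sumr; apply: (@le_trans _ _ (\sum_(p.+1 <= t < n.+1)
    (2 * lag c (u b) t%:Z ^+ 2 + 2 * p%:R ^+ 2 * c2 *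
        \sum_(j < p) E (t%:Z - j%:Z) ^+ 2))).
    by apply: ler_sum => t _; exact: (unit_root_lag_le (th2 b) (u_rec b) t sc).
  rewrite big_split /= -!mulr_sumr; apply: lerD.
    rewrite -mulrA ler_wpM2l//.
    have e : \sum_(p.+1 <= t < n.+1) lag c (u b) t%:Z ^+ 2 =
        \sum_(p.+1 <= t < n.+1) lag (half b) (lag c y) t%:Z ^+ 2.
      by apply: eq_bigr => t _; rewrite -!lagM mulrC.
    rewrite e; case: b {e}.
      by apply: (le_trans (K1P _ _)); rewrite mulrDl lerDl mulr_ge0.
    by apply: (le_trans (K2P _ _)); rewrite mulrDl lerDr mulr_ge0.
  have -> : 2 * p%:R ^+ 3 * c2 * V = 2 * p%:R ^+ 2 * c2 * (p%:R * V) by ring.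
  by rewrite ler_wpM2l// !mulr_ge0// sqr_ge0.
have nV : n%:R <= n%:R `^ (1 + eta) :> R.
  by rewrite -[leLHS]powRr1// natr_powR_le//; lra.
(* the excitation bound trades [c2] for [Q / n], and [V] for [n ^ (1 + eta)] *)
have hu' b : c.[th b] ^+ 2 * n%:R `^ (2 - eta - eta) <=
    (2 * (K1 + K2) + 2 * p%:R ^+ 3 * (K / k)) * Q.
  have W0 : 0 < n%:R `^ (1 + eta) :> R by rewrite powR_gt0.
  rewrite -(ler_pM2r W0) -[leLHS]mulrA -natr_powRD//.
  rewrite (_ : 2 - eta - eta + (1 + eta) = 2 - eta + 1); last by ring.
  rewrite natr_powRD// powRr1// [leLHS]mulrA.
  apply: (le_trans (ler_wpM2r (ltW n0') (hu b))).
  have h1 : 2 * (K1 + K2) * Q * n%:R <= 2 * (K1 + K2) * Q * n%:R `^ (1 + eta).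
    by rewrite ler_wpM2l// !mulr_ge0// addr_ge0.
  have h2 : 2 * p%:R ^+ 3 * c2 * V * n%:R <=
      2 * p%:R ^+ 3 * (K / k) * Q * n%:R `^ (1 + eta).
    have h : n%:R * c2 * V <= K / k * Q * n%:R `^ (1 + eta).
      by apply: ler_pM => //; rewrite mulr_ge0.
    have -> : 2 * p%:R ^+ 3 * c2 * V * n%:R = 2 * p%:R ^+ 3 * (n%:R * c2 * V) by ring.
    have -> : 2 * p%:R ^+ 3 * (K / k) * Q * n%:R `^ (1 + eta) =
        2 * p%:R ^+ 3 * (K / k * Q * n%:R `^ (1 + eta)) by rewrite !mulrA.
    by rewrite ler_wpM2l// mulr_ge0 ?exprn_ge0.
  by rewrite mulrDl [X in _ <= X * _]mulrDl [leRHS]mulrDl lerD.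
have hx : n%:R `^ (1 - eta - eta) * \sum_i x 0 i ^+ 2 <= Kp * (K / k) * Q.
  apply: (@le_trans _ _ (n%:R * \sum_i x 0 i ^+ 2)).
    rewrite ler_wpM2r//; first by apply: sumr_ge0 => i _; exact: sqr_ge0.
    by rewrite -[leRHS]powRr1// natr_powR_le//; lra.
  rewrite -mulrA; apply: (@le_trans _ _ (Kp * (n%:R * c2))); last by rewrite ler_wpM2l.
  by rewrite mulrCA ler_wpM2l.
have hQ : C * Q <= n%:R `^ eta * Q by rewrite ler_wpM2r.
have We : 0 < n%:R `^ eta :> R by rewrite powR_gt0.
rewrite -(ler_pM2l We); apply: le_trans hQ.
rewrite mulr_sumr.
have hexp i : n%:R `^ eta * (n%:R `^ (ex i - dl) * x 0 i ^+ 2) =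
    n%:R `^ (ex i - eta - eta) * x 0 i ^+ 2.
  by rewrite mulrA -natr_powRD//; congr (_ `^ _ * _); rewrite /eta; lra.
rewrite (eq_bigr _ (fun i _ => hexp i)).
(* The values of [c] at [1] and [-1] are the sum and the difference of the first two coordinates, so
   adding the two bounds recovers both squares. *)
have x01 : n%:R `^ (2 - eta - eta) * (x 0 0 ^+ 2 + x 0 1 ^+ 2) <=
    (2 * (K1 + K2) + 2 * p%:R ^+ 3 * (K / k)) * Q.
  have := hu' true; have := hu' false; rewrite !horner_lag_comb//.
  by rewrite /th expr0 expr1; nra.
rewrite /C mulrDl.
rewrite !big_ord_recl addrA; apply: lerD.
  apply: le_trans x01; rewrite /ex /= mulrDr.
  by rewrite (_ : lift ord0 ord0 = 1 :> 'I_p)//; exact: val_inj.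
apply: le_trans hx; rewrite !big_ord_recl !mulrDr addrA mulr_sumr.
rewrite ler_wpDl//; first by rewrite addr_ge0// mulr_ge0 ?powR_ge0 ?sqr_ge0.
Unshelve. all: by end_near. Qed.

Lemma gram_det_order :
  (fun n : nat => (ln n%:R)^-1 * ln (\det (lag_gram p y n))) @ \oo -->
    (p%:R + 2 : R).
Proof.
have sum_ex dl : \sum_i (ex i + dl) = p%:R + 2 + p%:R * dl.
  rewrite big_split sumr_const card_ord mulr_natl /=; congr (_ + _).
  rewrite !big_ord_recl /ex /= sumr_const card_ord -[in RHS]addn2 natrD.
  by ring.
have prod_ex dl n : (0 < n)%N -> \prod_i n%:R `^ (ex i + dl) =
    n%:R `^ (p%:R + 2 + p%:R * dl) :> R.
  move=> n0; rewrite -sum_ex; elim/big_rec2: _ => [|i a b _ ->].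
    by rewrite powRr0.
  by rewrite -natr_powRD.
have p0 : 0 < p%:R :> R by rewrite ltr0n.
have bounds dl : 0 < dl -> \forall n \near \oo,
    n%:R `^ (p%:R + 2 - dl) <= \det (lag_gram p y n) <= n%:R `^ (p%:R + 2 + dl).
  (* [dl] is shared equally among the [p] factors of the products. *)
  move=> dl0; have dp : 0 < dl / p%:R by rewrite divr_gt0.
  near=> n.
  have n0 : (0 < n)%N by near: n; exact: nbhs_infty_gt.
  have n0' : 0 < n%:R :> R by rewrite ltr0n.
  have quad : forall x : 'rV[R]_p, \sum_i n%:R `^ (ex i - dl / p%:R) * x 0 i ^+ 2 <=
    (x *m basis_gram p y n *m x^T) 0 0 by near: n; exact: quad_lb.
  have diag : forall i, basis_gram p y n i i <= n%:R `^ (ex i + dl / p%:R).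
    by near: n; apply: filter_forall => i; exact: diag_ub.
  have := sym_det_bounds (tr_basis_gram p y n) (fun i => powR_gt0 _ n0') quad.
  rewrite det_basis_gram => /andP[lo hi]; apply/andP; split.
    by apply: le_trans lo; rewrite prod_ex// mulrN mulrCA mulfV ?mulr1//.
  apply: (le_trans hi); rewrite -[X in _ + X](_ : p%:R * (dl / p%:R) = dl).
    rewrite -prod_ex//; apply: ler_prod => i _; rewrite diag andbT.
    by rewrite basis_gram_diag sumr_ge0// => t _; exact: sqr_ge0.
  by rewrite mulrCA mulfV ?mulr1.
by apply: poly_order_ln_cvg => dl dl0; near=> n;
  have /andP[] : n%:R `^ (p%:R + 2 - dl) <= \det (lag_gram p y n) <=
    n%:R `^ (p%:R + 2 + dl) by near: n; exact: bounds.
Unshelve. all: by end_near. Qed.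

End GramOrder.

(** * Martingales in independent noise *)

Section Independence.
Local Open Scope ereal_scope.
Context d (T : measurableType d) (R : realType) (P : probability T R).

(** By uniqueness on rectangles the joint law of [(X, Y)] is the product of the laws; Fubini then
    splits the integral. *)
Lemma indep_integral d1 d2 (T1 : measurableType d1) (T2 : measurableType d2)
    (X : {RV P >-> T1}) (Y : {RV P >-> T2}) (f : T1 -> R) (g : T2 -> R) :
  (forall A B, measurable A -> measurable B ->
    P (X @^-1` A `&` Y @^-1` B) = P (X @^-1` A) * P (Y @^-1` B)) ->
  measurable_fun setT f -> measurable_fun setT g ->
  P.-integrable setT (fun w => (f (X w))%:E) ->
  P.-integrable setT (fun w => (g (Y w))%:E) ->
  P.-integrable setT (fun w => (f (X w) * g (Y w))%:E) /\
  \int[P]_w (f (X w) * g (Y w))%:E =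
    (\int[P]_w (f (X w))%:E) * (\int[P]_w (g (Y w))%:E).
Proof.
move=> XY mf mg iX iY.
pose T12 : measurableType _ := (T1 * T2)%type.
have mXY : measurable_fun setT ((fun w => (X w, Y w)) : T -> T12).
  exact: measurable_fun_pair.
pose Z : {mfun T >-> T12} := mfun_Sub (mem_set mXY).
pose h (z : T12) : \bar R := (f z.1 * g z.2)%:E.
have mh : measurable_fun setT h.
  apply/measurable_EFinP; apply: measurable_funM; exact: measurableT_comp.
have mF : measurable_fun setT (EFin \o f) by exact/measurable_EFinP.
have mG : measurable_fun setT (EFin \o g) by exact/measurable_EFinP.
have mF' : measurable_fun setT (fun x => `|f x|%:E).
  by apply/measurable_EFinP; exact: measurableT_comp.
have mG' : measurable_fun setT (fun x => `|g x|%:E).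
  by apply/measurable_EFinP; exact: measurableT_comp.
have prodE S : measurable S ->
    (distribution P X \x distribution P Y) S = distribution P Z S.
  by apply: product_measure_unique => A B mA mB; exact: XY.
have absF : \int[distribution P X]_x `|f x|%:E < +oo.
  by rewrite ge0_integral_distribution//; move/integrableP : iX => [].
have absG : \int[distribution P Y]_x `|g x|%:E < +oo.
  by rewrite ge0_integral_distribution//; move/integrableP : iY => [].
have i12 : (distribution P X \x distribution P Y).-integrable setT h.
  apply/integrable12ltyP => //.
  have e x : \int[distribution P Y]_y `|h (x, y)| =
      `|f x|%:E * \int[distribution P Y]_y `|g y|%:E.
    rewrite -ge0_integralZl//=.
    by apply: eq_integral => y _; rewrite /h /= normrM EFinM.
  under eq_integral do rewrite e.
  have k0 : 0 <= \int[distribution P Y]_y `|g y|%:E by exact: integral_ge0.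
  rewrite ge0_integralZr//=.
  have f0 : 0 <= \int[distribution P X]_x `|f x|%:E by exact: integral_ge0.
  by apply: lte_mul_pinfty => //; rewrite ge0_fin_numE.
have JE k : \int[distribution P Z]_z k z =
    \int[(distribution P X \x distribution P Y)]_z k z.
  by apply: eq_measure_integral => A mA _; exact/esym/prodE.
have iZ : P.-integrable setT (h \o Z).
  apply/integrableP; split; first exact: measurableT_comp.
  move/integrableP : i12 => [_]; rewrite -JE ge0_integral_distribution//.
  exact: measurableT_comp.
split; first exact: iZ.
rewrite -[LHS](integral_distribution mh iZ) JE -integral12_prod_meas1//.
have iF : (distribution P X).-integrable setT (EFin \o f).
  by apply/integrableP; split.
have iG : (distribution P Y).-integrable setT (EFin \o g).
  by apply/integrableP; split.
rewrite /fubini_F.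
under eq_integral => x _.
  rewrite /h/= (_ : (fun y => _) = fun y => (f x)%:E * (g y)%:E); last by [].
  rewrite integralZl//.
  over.
rewrite -(integral_distribution mF iX)// -(integral_distribution mG iY)//.
have fG : \int[distribution P Y]_y (g y)%:E \is a fin_num.
  exact: integrable_fin_num.
by rewrite -(fineK fG) integralZr.
Qed.

End Independence.

Section Past.
Local Open Scope ereal_scope.
Context d (T : measurableType d) (R : realType) (P : probability T R).
Variable eps : nat -> {RV P >-> R}.

(* A pi-system generating the sigma-algebra of [eps 1, ..., eps (t - 1)] *)
Definition past (t : nat) : set (set T) :=
  [set A | exists2 B : nat -> set R, forall i, measurable (B i) &
     A = \bigcap_(i in [set i | (0 < i < t)%N]) eps i @^-1` B i].

Lemma past_measurable t : past t `<=` measurable.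
Proof.
move=> _ [B mB ->]; have [t2|t2] := leqP t 1.
  rewrite (_ : [set i | _] = set0) ?bigcap_set0//.
  by apply/seteqP; split => // i /= /andP[i0 it]; lia.
apply: bigcap_measurable => [|k _]; first by exists 1%N.
by rewrite -[_ @^-1` _]setTI; exact: measurable_funP.
Qed.

Lemma past_setI_closed t : setI_closed (past t).
Proof.
move=> _ _ [B mB ->] [C mC ->]; exists (fun i => B i `&` C i).
  by move=> i; exact: measurableI.
by rewrite -bigcapI.
Qed.

Lemma sigma_past_measurable t : <<s past t >> `<=` measurable.
Proof.
by apply: smallest_sub; [exact: sigma_algebra_measurable|exact: past_measurable].
Qed.

Hypothesis eps_indep : mutually_independent [set t : nat | (1 <= t)%N] eps.

(** Both sides are finite measures in [A]: the restriction of [P] to the event [E], and a multiple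
    of [P]. They agree on the pi-system [past t] by mutual independence, hence on the sigma-algebra
    it generates. *)
Lemma past_indep t A B : (0 < t)%N -> <<s past t >> A -> measurable B ->
  P (A `&` eps t @^-1` B) = P A * P (eps t @^-1` B).
Proof.
move=> t0 sA mB; set E := eps t @^-1` B.
have mE : measurable E by rewrite /E -[_ @^-1` _]setTI; exact: measurable_funP.
have fE : P E \is a fin_num by exact: fin_num_measure.
have gen A' : past t A' -> P (A' `&` E) = P A' * P E.
  (* Placing [B] at index [t] lets one family of sets serve both the past indices and the past
     indices together with [t]. *)
  move=> [C mC ->]; pose C' i := if i == t then B else C i.
  have mC' i : measurable (C' i) by rewrite /C'; case: ifP.
  pose F := [fset i in iota 1 t.-1]%fset.
  have Fi i : (i \in F) = (0 < i < t)%N by rewrite inE /= mem_iota; lia.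
  have tF : t \notin F by rewrite Fi; lia.
  have Fs : [set` F] = [set i | (0 < i < t)%N].
    by apply/seteqP; split => i /=; rewrite Fi.
  have FC i : i \in F -> C' i = C i.
    by rewrite Fi /C' => /andP[_ it]; rewrite ltn_eqF.
  have h1 := eps_indep (F := F) (B := C').
  have h2 := eps_indep (F := (t |` F)%fset) (B := C').
  have e1 : \bigcap_(i in [set` F]) eps i @^-1` C' i =
      \bigcap_(i in [set i | (0 < i < t)%N]) eps i @^-1` C i.
    by rewrite -Fs; apply: eq_bigcapr => i /= /FC ->.
  have e2 : \bigcap_(i in [set` (t |` F)%fset]) eps i @^-1` C' i =
      \bigcap_(i in [set i | (0 < i < t)%N]) eps i @^-1` C i `&` E.
    rewrite set_fsetU1 bigcap_setU1 setIC e1; congr (_ `&` _).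
    by rewrite /C' eqxx.
  rewrite -e2 -e1 h2// ?h1//.
  - by rewrite big_fsetU1//= muleC /C' eqxx.
  - by move=> i /=; rewrite Fi => /andP[].
  - by move=> i /=; rewrite in_fset1U Fi => /orP[/eqP ->//|/andP[]].
pose m1 := mrestr P mE.
pose r : {nonneg R} := NngNum (fine_ge0 (measure_ge0 P E)).
pose m2 := mscale r P.
have eH : [set X | past t X /\ X `<=` setT] = past t.
  by apply/seteqP; split => [X []|X pX]//; split.
have := @g_sigma_algebra_measure_unique_trace _ R T (past t) setT measurableT
  _ _ m1 m2.
rewrite eH => /(_ (@past_measurable t) (@past_setI_closed t)) H.
have e1 X : m1 X = P (X `&` E) by [].
have e2 X : m2 X = P X * P E by rewrite [LHS](_ : _ = (fine (P E))%:E * P X)// fineK// muleC.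
suff : m1 A = m2 A by rewrite e1 e2.
apply: H => //.
- by rewrite [LHS]e1 [RHS]e2 setTI [X in X * _]probability_setT mul1e.
- by move=> A' /gen h; rewrite [LHS]e1 [RHS]e2.
- by rewrite [ltLHS]e1 setTI ltey_eq fE.
Qed.

(** Predictability: [X] is determined by the noise strictly before time [t]. *)
Definition past_fun (t : nat) (X : T -> R) :=
  measurable_fun ([set: g_sigma_algebraType (past t)]) X.

Lemma past_fun_measurable t X : past_fun t X -> measurable_fun [set: T] X.
Proof.
move=> mX _ B mB; apply: (@sigma_past_measurable t).
by have := mX measurableT _ mB.
Qed.

Lemma past_fun_eps i t : (0 < i < t)%N -> past_fun t (eps i).
Proof.
move=> it _ B mB; rewrite setTI; apply: sub_gen_smallest.
exists (fun j => if j == i then B else setT) => [j|]; first by case: ifP.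
apply/seteqP; split => [w /= Bw j /= _|w /= /(_ i it)/=]; last by rewrite eqxx.
by case: eqP => [->|].
Qed.

Lemma past_funS s t X : (s <= t)%N -> past_fun s X -> past_fun t X.
Proof.
move=> st mX _ B mB; have := mX measurableT _ mB.
apply: sub_sigma_algebra2 => _ [C mC ->].
exists (fun j => if (j < s)%N then C j else setT) => [j|]; first by case: ifP.
apply/seteqP; split => w /= h j /= /andP[j0 js].
  by case: ifP => // js'; apply: h; rewrite /= j0 js'.
by have := h j; rewrite /= js => /(_ _); apply; rewrite j0 (leq_trans js).
Qed.

Lemma past_fun_integral t (X : T -> R) (g : R -> R) : (0 < t)%N ->
  past_fun t X -> measurable_fun setT g ->
  P.-integrable setT (fun w => (X w)%:E) ->
  P.-integrable setT (fun w => (g (eps t w))%:E) ->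
  P.-integrable setT (fun w => (X w * g (eps t w))%:E) /\
  \int[P]_w (X w * g (eps t w))%:E =
    (\int[P]_w (X w)%:E) * (\int[P]_w (g (eps t w))%:E).
Proof.
move=> t0 pX mg iX ig; have mX := past_fun_measurable pX.
pose X' : {RV P >-> R} := mfun_Sub (mem_set mX).
apply: (@indep_integral _ _ _ P _ _ _ _ X' (eps t) id g) => // A B mA mB.
by apply: past_indep => //; have := pX measurableT _ mA; rewrite setTI.
Qed.

End Past.

(** * Second moments of martingale transforms *)

Section Martingale.
Local Open Scope ereal_scope.
Context d (T : measurableType d) (R : realType) (P : probability T R).

Implicit Types X Y : T -> R.

Definition intble (X : T -> R) := P.-integrable setT (fun w => (X w)%:E).

Lemma intble_ext X Y : X =1 Y -> intble X -> intble Y.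
Proof. by move=> /funext ->. Qed.

Lemma intbleD X Y : intble X -> intble Y ->
  intble (fun w => X w + Y w)%R /\
  \int[P]_w (X w + Y w)%:E = \int[P]_w (X w)%:E + \int[P]_w (Y w)%:E.
Proof.
move=> iX iY; rewrite -(@integralD _ _ _ P setT)//; split => //.
by have h := integrableD measurableT iX iY; exact: h.
Qed.

Lemma intble_le X Y : measurable_fun setT X -> (forall w, `|X w| <= Y w)%R ->
  intble Y -> intble X.
Proof.
move=> mX XY iY; apply: (@le_integrable _ _ _ P setT) iY => //.
  exact/measurable_EFinP.
by move=> w _; rewrite /= lee_fin (le_trans (XY w))// ler_norm.
Qed.

Lemma intble_mulr X Y : measurable_fun setT X -> measurable_fun setT Y ->
  intble (fun w => X w ^+ 2)%R -> intble (fun w => Y w ^+ 2)%R ->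
  intble (fun w => X w * Y w)%R.
Proof.
move=> mX mY iX iY; have [iXY _] := intbleD iX iY.
apply: intble_le iXY; first exact: measurable_funM.
move=> w; rewrite normrM -[X in (_ <= X + _)%R]real_normK ?num_real//.
rewrite -[X in (_ <= _ + X)%R]real_normK ?num_real//.
have := sqr_ge0 (`|X w| - `|Y w|); have := normr_ge0 (X w).
have := normr_ge0 (Y w); nra.
Qed.

Lemma intble_cst k : intble (fun=> k).
Proof. exact: finite_measure_integrable_cst. Qed.

Lemma intble_sqrt X : measurable_fun setT X -> intble (fun w => X w ^+ 2)%R ->
  intble X.
Proof.
move=> mX iX; apply: (intble_ext (fun w => mulr1 (X w))).
by apply: intble_mulr => //; apply: intble_ext (intble_cst 1) => w; rewrite expr1n.
Qed.

Variable eps : nat -> {RV P >-> R}.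
Hypothesis eps_indep : mutually_independent [set t : nat | (1 <= t)%N] eps.
Variables (g : R -> R) (v : R).
Hypothesis mg : measurable_fun setT g.
Hypothesis g2 : forall t, (0 < t)%N -> intble (fun w => g (eps t w) ^+ 2)%R /\
  \int[P]_w (g (eps t w) ^+ 2)%:E = v%:E.
Hypothesis g1 : forall t, (0 < t)%N -> \int[P]_w (g (eps t w))%:E = 0.
Variables (m : nat) (X : nat -> T -> R).
Hypothesis m0 : (0 < m)%N.
Hypothesis X_past : forall s, (m <= s)%N -> past_fun eps s (X s).
Hypothesis X2 : forall s, (m <= s)%N -> intble (fun w => X s w ^+ 2)%R.

Let M N w : R := (\sum_(m <= s < N) X s w * g (eps s w))%R.

(** Orthogonality of increments: [M N] and [X N] are predictable and [g (eps N)] is centred, so the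
    cross term integrates to zero. Later [g] is the identity, or a centred truncation of the
    square. *)
Lemma martingale_sqr_integral N : (m <= N)%N ->
  [/\ past_fun eps N (M N), intble (fun w => M N w ^+ 2)%R,
    intble (fun w => \sum_(m <= s < N) X s w ^+ 2)%R &
    \int[P]_w (M N w ^+ 2)%:E =
      v%:E * \int[P]_w (\sum_(m <= s < N) X s w ^+ 2)%:E].
Proof.
elim: N => [|N IH]; first by rewrite leqNgt m0.
rewrite leq_eqVlt => /orP[/eqP mN|].
  have M0 : M N.+1 = fun=> 0%R by apply/funext => w; rewrite /M big_geq// mN.
  have Q0 w : (\sum_(m <= s < N.+1) X s w ^+ 2 = 0)%R by rewrite big_geq// mN.
  rewrite M0; split.
  - exact: measurable_cst.
  - by apply: intble_ext (intble_cst 0) => w; rewrite expr0n.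
  - by apply: intble_ext (intble_cst 0) => w; rewrite Q0.
  - under eq_integral do rewrite expr0n/=.
    by under [in RHS]eq_integral do rewrite Q0; rewrite integral0 mule0.
rewrite ltnS => mN; have [pM iM iQ eM] := IH mN.
have N0 : (0 < N)%N by exact: leq_trans mN.
have ME w : M N.+1 w = (M N w + X N w * g (eps N w))%R.
  by rewrite /M big_nat_recr.
have QE w : (\sum_(m <= s < N.+1) X s w ^+ 2 =
    \sum_(m <= s < N) X s w ^+ 2 + X N w ^+ 2)%R by rewrite big_nat_recr.
have pX := X_past mN; have iX := X2 mN.
have mM := past_fun_measurable pM; have mX := past_fun_measurable pX.
have mgN : measurable_fun setT (fun w => g (eps N w)) by exact: measurableT_comp.
have [ig2 eg2] := g2 N0.
have ig : intble (fun w => g (eps N w)) by exact: intble_sqrt.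
have pMX : past_fun eps N (fun w => 2 * (M N w * X N w))%R.
  by apply: measurable_funM => //; exact: measurable_funM.
have iMX : intble (fun w => 2 * (M N w * X N w))%R.
  have iMX := intble_mulr mM mX iM iX.
  have [iMX2 _] := intbleD iMX iMX.
  by apply: intble_ext iMX2 => w; rewrite mulr_natl mulr2n.
have [ic ec] := past_fun_integral eps_indep N0 pMX mg iMX ig.
have pX2 : past_fun eps N (fun w => X N w ^+ 2)%R by exact: measurable_funX.
have mg2 : measurable_fun setT (fun x => g x ^+ 2)%R by exact: measurable_funX.
have [id ed] := past_fun_integral (g := fun x => (g x ^+ 2)%R) eps_indep N0 pX2 mg2 iX ig2.
have [iMc eMc] := intbleD iM ic.
have [iMd eMd] := intbleD iMc id.
have M2E w : (M N.+1 w ^+ 2 = M N w ^+ 2 + 2 * (M N w * X N w) * g (eps N w)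
   + X N w ^+ 2 * g (eps N w) ^+ 2)%R by rewrite ME; ring.
have [iQX eQX] := intbleD iQ iX.
split.
- rewrite (_ : M N.+1 = fun w => (M N w + X N w * g (eps N w))%R); last exact/funext.
  apply: measurable_funD; first by apply: past_funS pM.
  apply: measurable_funM; first by apply: past_funS pX.
  apply: (measurableT_comp mg); apply: past_fun_eps; rewrite N0 ltnS leqnn//.
- by apply: intble_ext iMd => w; rewrite M2E.
- by apply: intble_ext iQX => w; rewrite QE.
under eq_integral do rewrite M2E.
under [in RHS]eq_integral do rewrite QE.
rewrite eMd eMc eQX eM ec ed (g1 N0) mule0 adde0 eg2 [X in _ + X]muleC.
set a := \int[P]_w _; set b := \int[P]_w _.
have fa : a \is a fin_num := integrable_fin_num measurableT iQ.
by rewrite [RHS]muleDr ?fin_num_adde_defr.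
Qed.

End Martingale.

(** * Almost sure bounds *)

Section AlmostSure.
Context d (T : measurableType d) (R : realType) (P : probability T R).

Lemma borel_cantelli_geometric (A : nat -> set T) (C r : R) :
  (forall k, measurable (A k)) -> 0 < C -> 0 < r < 1 ->
  (forall k, (P (A k) <= (C * r ^+ k)%:E)%E) ->
  \forall w \ae P, \forall k \near \oo, ~ A k w.
Proof.
move=> mA C0 /andP[r0 r1] PA.
have lim0 : P (lim_sup_set A) = 0%E.
  apply: lim_sup_set_cvg0 => //; apply: (@le_lt_trans _ _ (C * (1 - r)^-1)%:E).
    apply: lime_le; first exact: is_cvg_nneseries.
    apply: nearW => n; apply: (@le_trans _ _ (series (geometric C r) n)%:E).
      by rewrite /series /= -sumEFin; apply: lee_sum => k _; exact: PA.
    by rewrite lee_fin; apply: geometric_le_lim => //; rewrite ?ltW ?gtr0_norm.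
  exact: ltry.
exists (lim_sup_set A); split => //.
  by apply: bigcap_measurable => // n _; exact: bigcup_measurable.
move=> w /= H n _; apply: contrapT => nA; apply: H; exists n => // k /= nk Ak.
by apply: nA; exists k.
Qed.

Lemma markov_ge0 (Z : T -> R) (a c : R) : measurable_fun setT Z ->
  (forall w, 0 <= Z w) -> 0 < a -> (\int[P]_w (Z w)%:E <= c%:E)%E ->
  (P [set w | (a < Z w)%R] <= (c / a)%:E)%E.
Proof.
move=> mZ Z0 a0 Zc.
have mA : measurable [set w | a < Z w].
  rewrite (_ : [set w | a < Z w] = Z @^-1` `]a, +oo[%classic).
    by rewrite -[_ @^-1` _]setTI; exact: mZ.
  by apply/seteqP; split => w /=; rewrite in_itv/= andbT.
have fA : P [set w | (a < Z w)%R] \is a fin_num by exact: fin_num_measure.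
suff : (a%:E * P [set w | (a < Z w)%R] <= c%:E)%E.
  by rewrite -(fineK fA) -EFinM !lee_fin ler_pdivlMr// mulrC.
apply: le_trans Zc; rewrite -[in P _](setIT [set w | a < Z w]) -integral_indic// -ge0_integralZl//=.
- apply: ge0_le_integral => //=.
  + by move=> w _; rewrite lee_fin mulr_ge0 ?(ltW a0)// indicE.
  + by apply/measurable_EFinP; apply: measurable_funM => //; exact: measurable_indic.
  + exact/measurable_EFinP.
  + move=> w _; rewrite lee_fin indicE; case: (boolP (w \in _)) => [|_].
      by rewrite inE /= mulr1 => /ltW.
    by rewrite mulr0.
- by apply/measurable_EFinP; exact: measurable_indic.
- by rewrite lee_fin ltW.
Qed.

(** Along [n = 2 ^ k], Markov's inequality gives probabilities decaying geometrically in [k], to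
    which Borel-Cantelli applies. The countably many values [1 / (j + 1)] of [dl] suffice, which
    brings the quantifier on [dl] inside the almost sure event. *)
Lemma as_poly_ub_pow2 (Z : nat -> T -> R) (e c : R) :
  (forall n, measurable_fun setT (Z n)) -> (forall n w, 0 <= Z n w) -> 0 < c ->
  (forall n, (0 < n)%N -> (\int[P]_w (Z n w)%:E <= (c * n%:R `^ e)%:E)%E) ->
  \forall w \ae P, forall dl : R, 0 < dl ->
    \forall k \near \oo, Z (2 ^ k)%N w <= (2 ^ k)%N%:R `^ (e + dl).
Proof.
move=> mZ Z0 c0 Zc.
pose dl j : R := j.+1%:R^-1.
have dl0 j : 0 < dl j by rewrite invr_gt0.
have H j : \forall w \ae P, \forall k \near \oo,
    ~ ((2 ^ k)%N%:R `^ (e + dl j) < Z (2 ^ k)%N w).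
  pose r : R := 2 `^ (- dl j).
  have n0 k : 0 < (2 ^ k)%N%:R :> R by rewrite ltr0n expn_gt0.
  apply: (@borel_cantelli_geometric _ c r) => //.
  - move=> k; rewrite (_ : (fun w => _) = Z (2 ^ k)%N @^-1`
       `](2 ^ k)%N%:R `^ (e + dl j), +oo[%classic).
      by rewrite -[_ @^-1` _]setTI; exact: mZ.
    by apply/seteqP; split => w /=; rewrite in_itv/= andbT.
  - have := @gt0_ltr_powR R _ (dl0 j) 1 2; rewrite powR1 !nnegrE => h.
    by rewrite powR_gt0//= /r powRN invf_lt1 ?powR_gt0// h// ltr1n.
  - move=> k; have := @markov_ge0 _ _ _ (mZ (2 ^ k)%N) (Z0 _) (powR_gt0 (e + dl j) (n0 k)) (Zc _ _).
    move=> /(_ (expn_gt0 _ _))/le_trans; apply; rewrite lee_fin -mulrA ler_wpM2l ?(ltW c0)//.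
    rewrite natr_powRD ?expn_gt0// invfM mulrA mulfV ?mul1r; last first.
      by rewrite gt_eqF// powR_gt0.
    rewrite -powRN /r -powR_mulrn ?powR_ge0// -!powRrM natrX -powR_mulrn// -powRrM.
    by rewrite mulrC.
have := ae_foralln H; apply: filterS => w Hw e' e'0.
have [j je] : exists j, dl j < e'.
  by have [j _ /(_ j (leqnn _))] := near_infty_natSinv_lt (PosNum e'0); exists j.
near=> k.
have h : ~ ((2 ^ k)%N%:R `^ (e + dl j) < Z (2 ^ k)%N w) by near: k; exact: Hw.
apply: (@le_trans _ _ ((2 ^ k)%N%:R `^ (e + dl j))); first by rewrite leNgt; apply/negP.
by rewrite natr_powR_le ?expn_gt0// lerD2l ltW.
Unshelve. all: by end_near. Qed.

End AlmostSure.

(** * From powers of two to all integers *)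

Section Dyadic.
Variable R : realType.
Implicit Types (a : nat -> R) (e : R).

Lemma near_trunc_log (Q : nat -> Prop) : (\forall k \near \oo, Q k) ->
  \forall n \near \oo, Q (trunc_log 2 n) /\ Q (trunc_log 2 n).+1.
Proof.
move=> [N _ HN]; exists (2 ^ N)%N => // n /= Nn.
have : (N <= trunc_log 2 n)%N by rewrite trunc_log_max.
by move=> h; split; apply: HN => //=; exact: leqW.
Qed.

Lemma trunc_log2_bounds n : (0 < n)%N ->
  (2 ^ trunc_log 2 n <= n < 2 ^ (trunc_log 2 n).+1)%N.
Proof. by move=> n0; exact: trunc_log_bounds. Qed.

(** Compare [a n] with its value at the next power of two, which is at most [2 * n]; half of [dl]
    absorbs the resulting constant. *)
Lemma poly_ub_dyadic e a : 0 <= e -> (forall m n, (m <= n)%N -> a m <= a n) ->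
  (forall dl : R, 0 < dl ->
     \forall k \near \oo, a (2 ^ k)%N <= (2 ^ k)%N%:R `^ (e + dl)) ->
  poly_ub e a.
Proof.
move=> e0 am ua dl dl0; have d2 : 0 < dl / 2 by lra.
have h := near_trunc_log (ua _ d2); near=> n.
have n0 : (0 < n)%N by near: n; exact: nbhs_infty_gt.
have [_ h1] : a (2 ^ trunc_log 2 n)%N <=
      (2 ^ trunc_log 2 n)%N%:R `^ (e + dl / 2) /\
    a (2 ^ (trunc_log 2 n).+1)%N <=
      (2 ^ (trunc_log 2 n).+1)%N%:R `^ (e + dl / 2) by near: n; exact: h.
have C : 2 `^ (e + dl / 2) <= n%:R `^ (dl / 2) by near: n; exact: near_ge_powR.
have /andP[lo hi] := trunc_log2_bounds n0.
apply: (le_trans (am _ _ (ltnW hi))); apply: (le_trans h1).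
apply: (@le_trans _ _ ((2 * n%:R) `^ (e + dl / 2))).
  apply: ge0_ler_powR; rewrite ?nnegrE ?mulr_ge0//; first by rewrite addr_ge0// ltW.
  by rewrite -natrM ler_nat expnS leq_mul2l.
rewrite powRM//; have -> : e + dl = dl / 2 + (e + dl / 2) by lra.
by rewrite (natr_powRD (dl / 2) _ n0) ler_wpM2r// powR_ge0.
Unshelve. all: by end_near. Qed.

Lemma poly_lb_dyadic e a : 0 < e -> (forall m n, (m <= n)%N -> a m <= a n) ->
  (forall dl : R, 0 < dl -> dl < e ->
     \forall k \near \oo, (2 ^ k)%N%:R `^ (e - dl) <= a (2 ^ k)%N) ->
  poly_lb e a.
Proof.
(* The cap [e / 2] keeps the exponent [e - dl] positive, so that the power increases with its
   base. *)
move=> e0 am la dl' dl'0; pose dl := Num.min (dl' / 2) (e / 2).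
have dl0 : 0 < dl by rewrite lt_min; apply/andP; split; lra.
have dle : dl < e by rewrite gt_min; apply/orP; right; lra.
have dl2 : dl <= dl' / 2 by rewrite ge_min lexx.
have d2 : 0 < dl' / 2 by lra.
have h := near_trunc_log (la _ dl0 dle); near=> n.
have n0 : (0 < n)%N by near: n; exact: nbhs_infty_gt.
have [h1 _] : (2 ^ trunc_log 2 n)%N%:R `^ (e - dl) <= a (2 ^ trunc_log 2 n)%N /\
    (2 ^ (trunc_log 2 n).+1)%N%:R `^ (e - dl) <= a (2 ^ (trunc_log 2 n).+1)%N.
  by near: n; exact: h.
have C : 2 `^ (e - dl) <= n%:R `^ (dl' / 2) by near: n; exact: near_ge_powR.
have /andP[lo hi] := trunc_log2_bounds n0.
apply: le_trans (am _ _ lo); apply: le_trans h1.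
have p0 : 0 < 2 `^ (e - dl) :> R by rewrite powR_gt0.
rewrite -(ler_pM2l p0) -powRM//.
apply: (@le_trans _ _ (n%:R `^ (e - dl))); last first.
  apply: ge0_ler_powR; rewrite ?nnegrE ?mulr_ge0//; first by lra.
  by rewrite -natrM ler_nat -expnS ltnW.
apply: (@le_trans _ _ (n%:R `^ (dl' / 2) * n%:R `^ (e - dl'))).
  by rewrite ler_wpM2r// powR_ge0.
by rewrite -natr_powRD// natr_powR_le//; lra.
Unshelve. all: by end_near. Qed.

Lemma near_pow2 (Q : nat -> Prop) : (\forall n \near \oo, Q n) ->
  \forall k \near \oo, Q (2 ^ k)%N.
Proof.
move=> [N _ HN]; exists N => // k /= Nk; apply: HN => /=.
by apply: (leq_trans Nk); apply: ltnW; exact: ltn_expl.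
Qed.

(** The off-diagonal part is at most [B] times the square of the sum of the [|c i|], hence at most
    [p * B] times the sum of squares. *)
Lemma quad_diag_dominant p (c : 'I_p -> R) (G : 'I_p -> 'I_p -> R) (D B : R) :
  0 <= B -> (forall i, D <= G i i) -> (forall i j, i != j -> `|G i j| <= B) ->
  (D - p%:R * B) * (\sum_i c i ^+ 2) <= \sum_i \sum_j c i * c j * G i j.
Proof.
move=> B0 GD GB.
apply: (@le_trans _ _ (\sum_i \sum_j
    ((if i == j then D * c i ^+ 2 else 0) - B * (`|c i| * `|c j|)))).
  have -> : \sum_i \sum_j ((if i == j then D * c i ^+ 2 else 0) -
      B * (`|c i| * `|c j|)) = D * (\sum_i c i ^+ 2) - B * (\sum_i `|c i|) ^+ 2.
    rewrite expr2 big_distrl /= !mulr_sumr -sumrB; apply: eq_bigr => i _.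
    rewrite sumrB -big_mkcond /= (eq_bigl (pred1 i)); last first.
      by move=> j; rewrite /= eq_sym.
    by rewrite big_pred1_eq -mulr_sumr -mulr_sumr.
  rewrite mulrBl lerD2l lerN2 [p%:R * B]mulrC -mulrA ler_wpM2l//.
  apply: (le_trans (sqr_sum_le _)).
  by under eq_bigr do rewrite real_normK ?num_real//.
apply: ler_sum => i _; apply: ler_sum => j _.
case: eqVneq => [<-|ij].
  have : 0 <= B * (`|c i| * `|c i|) by rewrite !mulr_ge0.
  have : D * c i ^+ 2 <= c i ^+ 2 * G i i by rewrite mulrC ler_wpM2l// sqr_ge0.
  by rewrite expr2; lra.
rewrite sub0r lerNl -normrM; apply: (le_trans (ler_norm _)).
by rewrite normrN [leLHS]normrM [leLHS]mulrC ler_wpM2r// GB.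
Qed.

End Dyadic.

(** * Deterministic estimates for one noise path *)

Section Paths.
Variables (R : realType) (x : nat -> R).

(** Along powers of two, the diagonal of the lagged Gram matrix of [x] is at least [mu * n] up to
    order [n ^ (3 / 4)], and its other entries have at most that order, so the diagonal
    dominates. *)
Lemma excitation_dyadic p (mu : R) : 0 < mu ->
  (\forall k \near \oo, (\sum_(1 <= t < (2 ^ k).+1) (Num.min (x t ^+ 2) 1 - mu)) ^+ 2
     <= (2 ^ k)%N%:R `^ (1 + 1 / 2)) ->
  (forall i j : 'I_p, (i < j)%N -> \forall k \near \oo,
     (\sum_(p.+1 <= t < (2 ^ k).+1) x (t - i)%N * x (t - j)%N) ^+ 2
     <= (2 ^ k)%N%:R `^ (1 + 1 / 2)) ->
  \forall n \near \oo, forall c : 'I_p -> R,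
    mu / 4 * n%:R * (\sum_i c i ^+ 2) <=
    \sum_(p.+1 <= t < n.+1) (\sum_i c i * x (t - i)%N) ^+ 2.
Proof.
move=> mu0 Ha Hb.
pose F n (c : 'I_p -> R) := \sum_(p.+1 <= t < n.+1) (\sum_i c i * x (t - i)%N) ^+ 2.
have Hb' : \forall k \near \oo, forall i j : 'I_p, (i < j)%N ->
     (\sum_(p.+1 <= t < (2 ^ k).+1) x (t - i)%N * x (t - j)%N) ^+ 2
     <= (2 ^ k)%N%:R `^ (1 + 1 / 2).
  apply: filter_forall => i; apply: filter_forall => j.
  have [ij|ji] := boolP (i < j)%N; first by apply: filterS (Hb _ _ ij).
  exact: nearW.
have dyadic : \forall k \near \oo, forall c : 'I_p -> R,
    mu / 2 * (2 ^ k)%N%:R * (\sum_i c i ^+ 2) <= F (2 ^ k)%N c.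
  (* Chosen so that [K * B <= n] yields [B + p + p * B <= mu * n / 2], given [1 <= B]. *)
  pose K : R := (2 * (p%:R + 1) + 2 * p%:R) / mu.
  have hK : \forall n \near \oo, K <= (n%:R : R) `^ (1 / 4).
    by apply: near_ge_powR; lra.
  have {}hK := near_pow2 hK.
  have hp := near_pow2 (nbhs_infty_gt p).
  near=> k => c.
  have hn : (p < 2 ^ k)%N by near: k; exact: hp.
  have hk : K <= (2 ^ k)%N%:R `^ (1 / 4) by near: k; exact: hK.
  have ha0 : (\sum_(1 <= t < (2 ^ k).+1) (Num.min (x t ^+ 2) 1 - mu)) ^+ 2
     <= (2 ^ k)%N%:R `^ (1 + 1 / 2) by near: k; exact: Ha.
  have hb0 : forall i j : 'I_p, (i < j)%N ->
     (\sum_(p.+1 <= t < (2 ^ k).+1) x (t - i)%N * x (t - j)%N) ^+ 2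
     <= (2 ^ k)%N%:R `^ (1 + 1 / 2) by near: k; exact: Hb'.
  set n := (2 ^ k)%N in hn hk ha0 hb0 *.
  have n0 : (0 < n)%N by rewrite expn_gt0.
  pose B : R := n%:R `^ (3 / 4).
  have B0 : 0 <= B by exact: powR_ge0.
  have BB : B ^+ 2 = n%:R `^ (1 + 1 / 2).
    by rewrite /B -powR_mulrn// -powRrM; congr (_ `^ _); lra.
  have B1 : 1 <= B.
    by have := @natr_powR_le R n 0 (3 / 4) n0; rewrite powRr0; apply; lra.
  have sqrB s : s ^+ 2 <= n%:R `^ (1 + 1 / 2) -> `|s| <= B.
    by move=> h; rewrite -ler_sqr ?nnegrE// BB real_normK ?num_real.
  have ha : `|\sum_(1 <= t < n.+1) (Num.min (x t ^+ 2) 1 - mu)| <= B.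
    exact: sqrB.
  have hb : forall i j : 'I_p, (i < j)%N ->
      `|\sum_(p.+1 <= t < n.+1) x (t - i)%N * x (t - j)%N| <= B.
    by move=> i j ij; apply: sqrB; exact: hb0.
  pose G (i j : 'I_p) := \sum_(p.+1 <= t < n.+1) x (t - i)%N * x (t - j)%N.
  pose D := mu * n%:R - B - p%:R.
  have -> : F n c = \sum_i \sum_j c i * c j * G i j.
    rewrite /F; under eq_bigr do rewrite expr2 big_distrl /=.
    rewrite exchange_big; apply: eq_bigr => i _ /=.
    under eq_bigr do rewrite big_distrr /=.
    rewrite exchange_big; apply: eq_bigr => j _ /=.
    by rewrite /G mulr_sumr; apply: eq_bigr => t _; ring.
  have GD i : D <= G i i.
    pose b t := Num.min (x t ^+ 2) 1.
    have b0 t : 0 <= b t by rewrite le_min sqr_ge0 ler01.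
    have b1 t : b t <= 1 by rewrite ge_min lexx orbT.
    have sb : mu * n%:R - B <= \sum_(1 <= t < n.+1) b t.
      move: ha; rewrite sumrB sumr_const_nat subn1 /= -mulr_natr ler_norml.
      by rewrite /b => /andP[h _]; lra.
    (* Shifting the window by [i] loses [p - i] terms at its start and [i] at its end, each at most
       [1]. *)
    have tot m1 m2 : (m1 <= m2)%N -> \sum_(m1 <= t < m2) b t <= (m2 - m1)%N%:R.
      move=> m12; apply: (@le_trans _ _ (\sum_(m1 <= t < m2) 1)).
        by apply: ler_sum.
      by rewrite sumr_const_nat.
    have ip := ltn_ord i.
    have e : p.+1 = ((p - i).+1 + i)%N by lia.
    apply: (@le_trans _ _ (\sum_((p - i).+1 <= t < n.+1 - i) b t)); last first.
      rewrite /G e big_addn; apply: ler_sum => t _.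
      by rewrite addnK -expr2 ge_min lexx.
    move: sb; rewrite (@big_cat_nat _ _ _ (p - i).+1 1 n.+1)/=; [|lia..].
    rewrite (@big_cat_nat _ _ _ (n.+1 - i) (p - i).+1 n.+1)/=; [|lia..].
    have t1 : \sum_(1 <= t < (p - i).+1) b t <= (p - i)%N%:R.
      by apply: (le_trans (tot _ _ _)); rewrite // subSS subn0.
    have t2 : \sum_(n.+1 - i <= t < n.+1) b t <= i%:R.
      by apply: (le_trans (tot _ _ _)); rewrite ?leq_subr// subKn//; lia.
    have pi : p%:R = (p - i)%N%:R + i%:R :> R by rewrite -natrD subnK// ltnW.
    by rewrite /D pi; move: t1 t2; lra.
  have GB i j : i != j -> `|G i j| <= B.
    rewrite neq_ltn => /orP[ij|ji]; first exact: hb.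
    rewrite (_ : G i j = G j i); first exact: hb.
    by apply: eq_bigr => t _; rewrite mulrC.
  have := quad_diag_dominant c B0 GD GB; apply: le_trans.
  rewrite ler_wpM2r//; first by apply: sumr_ge0 => i _; exact: sqr_ge0.
  have nB : n%:R = B * n%:R `^ (1 / 4).
    by rewrite /B -natr_powRD// -[LHS]powRr1//; congr (_ `^ _); lra.
  have : K * B <= n%:R by rewrite [leRHS]nB mulrC ler_wpM2l.
  rewrite /K mulrAC ler_pdivrMr// /D.
  have : p%:R <= p%:R * B by rewrite ler_peMr.
  by set N := n%:R; set q := p%:R; nra.
(* The form grows with [n], and the preceding power of two is at least [n / 2]; this halves the
   constant. *)
have h := near_trunc_log dyadic; near=> n => c.
have n0 : (0 < n)%N by near: n; exact: nbhs_infty_gt.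
have [hc _] : (forall c, mu / 2 * (2 ^ trunc_log 2 n)%N%:R * (\sum_i c i ^+ 2) <=
    F (2 ^ trunc_log 2 n)%N c) /\
    (forall c, mu / 2 * (2 ^ (trunc_log 2 n).+1)%N%:R * (\sum_i c i ^+ 2) <=
    F (2 ^ (trunc_log 2 n).+1)%N c) by near: n; exact: h.
have /andP[lo hi] := trunc_log2_bounds n0.
apply: (@le_trans _ _ (F (2 ^ trunc_log 2 n)%N c)).
  apply: le_trans (hc c); rewrite ler_wpM2r//.
    by apply: sumr_ge0 => i _; exact: sqr_ge0.
  have : n%:R <= 2 * (2 ^ trunc_log 2 n)%N%:R :> R.
    by rewrite -natrM ler_nat -expnS ltnW.
  by nra.
rewrite /F; have [pl|pl] := leqP p.+1 (2 ^ trunc_log 2 n).+1.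
  rewrite [leRHS](@big_cat_nat _ _ _ (2 ^ trunc_log 2 n).+1)//= lerDl.
  by apply: sumr_ge0 => t _; exact: sqr_ge0.
rewrite big_geq; last exact: ltnW.
by apply: sumr_ge0 => t _; exact: sqr_ge0.
Unshelve. all: by end_near. Qed.

Section Walk.
Variables (th : R).
Hypothesis th2 : th * th = 1.

Let S t := \sum_(1 <= s < t.+1) th ^+ s * x s.

(* Cutting the integrand off keeps its square function below [a]. *)
Definition stopped_walk (a : R) s :=
  if \sum_(1 <= r < s) (\sum_(1 <= i < r.+1) th ^+ i * x i) ^+ 2 <= a
  then th ^+ s * \sum_(1 <= i < s) th ^+ i * x i else 0.

(** The induction also carries the bound by [W n]: while [W n.+1 <= a] the sum stays below [W n.+1],
    and afterwards nothing is added. *)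
Lemma stopped_walk_sqr_sum a n : 0 <= a ->
  \sum_(1 <= s < n.+1) stopped_walk a s ^+ 2 <= a.
Proof.
move=> a0; pose W m := \sum_(1 <= r < m) S r ^+ 2.
suff [] : \sum_(1 <= s < n.+1) stopped_walk a s ^+ 2 <= a /\
    \sum_(1 <= s < n.+1) stopped_walk a s ^+ 2 <= W n by [].
have sqS s : (th ^+ s * S s.-1) ^+ 2 = S s.-1 ^+ 2.
  by rewrite exprMn -exprM mulnC exprM expr2 th2 expr1n mul1r.
elim: n => [|n [IHa IHW]]; first by rewrite /W !big_geq.
rewrite (big_nat_recr n.+1)//=.
have sE : stopped_walk a n.+1 = if W n.+1 <= a then th ^+ n.+1 * S n else 0 by [].
have WS : W n.+1 = W n + S n ^+ 2.
  case: (n) => [|m]; last by rewrite /W big_nat_recr.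
  by rewrite /W /S !big_geq// expr0n addr0.
have h : \sum_(1 <= s < n.+1) stopped_walk a s ^+ 2 + S n ^+ 2 <= W n.+1.
  by rewrite WS lerD2r.
rewrite sE; case: ifP => Wa.
  by rewrite (sqS n.+1); split => //; exact: le_trans h Wa.
rewrite expr0n addr0; split => //; apply: (le_trans IHW).
by rewrite WS lerDl sqr_ge0.
Qed.

Lemma walk_sqr t : S t ^+ 2 =
  2 * (\sum_(1 <= s < t.+1) th ^+ s * S s.-1 * x s) + \sum_(1 <= s < t.+1) x s ^+ 2.
Proof.
elim: t => [|t IH]; first by rewrite /S !big_geq// mulr0 addr0 expr0n.
rewrite {1}/S !(big_nat_recr t.+1)//= -/(S t) sqrrD IH exprMn.
by rewrite -[(th ^+ _) ^+ 2]exprM mulnC exprM expr2 th2 expr1n; ring.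
Qed.

(* If the squares [S t ^ 2] had a small sum, the martingale part of
   [S t ^ 2 = 2 sum S x + sum x ^ 2] would be negligible, which forces
   [S t ^ 2] to be of order [t]. *)
Lemma walk_lb_dyadic (c dl : R) : 0 < c -> 0 < dl ->
  (\forall n \near \oo, c * n%:R <= \sum_(1 <= t < n.+1) x t ^+ 2) ->
  (\forall k \near \oo, \sum_(1 <= t < (2 ^ k).+1)
     (\sum_(1 <= s < t.+1) stopped_walk ((2 ^ k)%N%:R `^ (2 - dl)) s * x s) ^+ 2 <=
     (2 ^ k)%N%:R `^ (3 - dl + dl / 2)) ->
  \forall k \near \oo, (2 ^ k)%N%:R `^ (2 - dl) <=
    \sum_(1 <= t < (2 ^ k).+1) S t ^+ 2.
Proof.
move=> c0 dl0 Hx HN.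
have Hx2 := near_pow2 Hx.
(* As [h = n / 2], this gives [c * h ^ 2] at least [13 / 4] units of [n ^ (2 - dl / 4)]. The
   martingale part takes at most two units and the assumed upper bound one, and [13 / 4 > 3]. *)
have hK : \forall n \near \oo, 13 / c <= (n%:R : R) `^ (dl / 4).
  by apply: near_ge_powR; lra.
have {}hK := near_pow2 hK.
have [k0 _ hx] := Hx2.
near=> k.
have k1 : (k0 < k)%N by near: k; exact: nbhs_infty_gt.
have xN : \sum_(1 <= t < (2 ^ k).+1) (\sum_(1 <= s < t.+1)
    stopped_walk ((2 ^ k)%N%:R `^ (2 - dl)) s * x s) ^+ 2 <=
    (2 ^ k)%N%:R `^ (3 - dl + dl / 2) by near: k; exact: HN.
have nK : 13 / c <= (2 ^ k)%N%:R `^ (dl / 4) by near: k; exact: hK.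
set n := (2 ^ k)%N in xN nK *; have n0 : (0 < n)%N by rewrite expn_gt0.
pose h := (2 ^ k.-1)%N.
have nh : n = (h + h)%N by rewrite /n /h -(@prednK k) ?expnS ?mul2n ?addnn//; lia.
have hn : n%:R = 2 * h%:R :> R by rewrite nh natrD; ring.
have xh : c * h%:R <= \sum_(1 <= t < h.+1) x t ^+ 2 by apply: hx => /=; lia.
rewrite leNgt; apply/negP => small.
set A := n%:R `^ (2 - dl) in small xN.
pose N t := \sum_(1 <= s < t.+1) stopped_walk A s * x s.
(* Under the assumption [small] the cutoff does not act up to time [n]. *)
have NE t : (t <= n)%N -> N t = \sum_(1 <= s < t.+1) th ^+ s * S s.-1 * x s.
  move=> tn; apply: eq_big_nat => s /andP[s1 st]; rewrite /stopped_walk ifT.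
    by case: s s1 st.
  apply: ltW; apply: le_lt_trans small.
  rewrite [leRHS](@big_cat_nat _ _ _ s)//=; last by lia.
  by rewrite lerDl; apply: sumr_ge0 => r _; exact: sqr_ge0.
(* The weight in [- 2 * N t <= N t ^ 2 / a + a]. With this exponent both terms sum to at most
   [n ^ (2 - dl / 4)]. *)
pose a := n%:R `^ (1 - dl / 4).
have a0 : 0 < a by rewrite powR_gt0 ?ltr0n.
have lbN t : - (N t ^+ 2 / a + a) <= 2 * N t.
  rewrite -subr_ge0 opprK.
  have -> : 2 * N t + (N t ^+ 2 / a + a) = (N t + a) ^+ 2 / a.
    by field; rewrite gt_eqF.
  by rewrite divr_ge0 ?sqr_ge0// ltW.
have sumN : - (2 * n%:R `^ (2 - dl / 4)) <= \sum_(1 <= t < n.+1) 2 * N t.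
  apply: (@le_trans _ _ (\sum_(1 <= t < n.+1) - (N t ^+ 2 / a + a))).
    rewrite sumrN lerN2 big_split /= -mulr_suml sumr_const_nat subn1 /= mulr2n.
    rewrite mulrDl mul1r; apply: lerD.
      rewrite ler_pdivrMr// -natr_powRD//; apply: (le_trans xN).
      by rewrite natr_powR_le//; lra.
    rewrite -[leLHS]mulr_natl -[X in X * _ <= _]powRr1// /a -natr_powRD//.
    by rewrite natr_powR_le//; lra.
  by apply: ler_sum => t _; exact: lbN.
(* For each of the last [h] times, the inner sum is already at least [c * h]. *)
have sumQ : c * h%:R ^+ 2 <= \sum_(1 <= t < n.+1) \sum_(1 <= s < t.+1) x s ^+ 2.
  rewrite [leRHS](@big_cat_nat _ _ _ h.+1)//=; last by lia.
  apply: ler_wpDl.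
    by apply: sumr_ge0 => t _; apply: sumr_ge0 => s _; exact: sqr_ge0.
  apply: (@le_trans _ _ (\sum_(h.+1 <= t < n.+1) c * h%:R)).
    by rewrite sumr_const_nat subSS nh addnK -[leRHS]mulr_natr expr2 mulrA.
  apply: ler_sum_nat => t /andP[ht tn].
  apply: (le_trans xh); rewrite [leRHS](@big_cat_nat _ _ _ h.+1)//=; last by lia.
  by rewrite lerDl; apply: sumr_ge0 => s _; exact: sqr_ge0.
have SE : \sum_(1 <= t < n.+1) S t ^+ 2 = \sum_(1 <= t < n.+1) 2 * N t +
    \sum_(1 <= t < n.+1) \sum_(1 <= s < t.+1) x s ^+ 2.
  rewrite -big_split /=; apply: eq_big_nat => t /andP[_ tn].
  by rewrite walk_sqr NE.
have A1 : A <= n%:R `^ (2 - dl / 4) by rewrite natr_powR_le//; lra.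
have n2 : n%:R ^+ 2 = n%:R `^ (2 - dl / 4) * n%:R `^ (dl / 4) :> R.
  by rewrite -natr_powRD// -powR_mulrn//; congr (_ `^ _); lra.
have hh : c * h%:R ^+ 2 = c / 4 * n%:R ^+ 2 by rewrite hn; field.
have P0 : 0 < n%:R `^ (2 - dl / 4) :> R by rewrite powR_gt0 ?ltr0n.
have : 13 / 4 * n%:R `^ (2 - dl / 4) <= c * h%:R ^+ 2.
  rewrite hh n2 mulrCA [leRHS]mulrC ler_wpM2r ?(ltW P0)//.
  by move: nK; rewrite ler_pdivrMr//; lra.
move: small; rewrite SE; move: sumN sumQ A1 P0; lra.
Unshelve. all: by end_near. Qed.

End Walk.
End Paths.

Lemma measurable_sum_nat (R : realType) d (T : measurableType d)
    (X : nat -> T -> R) m n :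
  (forall s, (m <= s < n)%N -> measurable_fun setT (X s)) ->
  measurable_fun setT (fun w => \sum_(m <= s < n) X s w).
Proof.
elim: n => [|n IH] mX.
  by under eq_fun do rewrite big_geq//; exact: measurable_cst.
have [mn|nm] := leqP m n; last first.
  by under eq_fun do rewrite big_geq//; exact: measurable_cst.
under eq_fun do rewrite big_nat_recr//=; apply: measurable_funD.
  by apply: IH => s /andP[ms sn]; apply: mX; rewrite ms ltnS ltnW.
by apply: mX; rewrite mn ltnSn.
Qed.

(** * Almost sure behaviour of the noise *)

Section Noise.
Context (R : realType) (d : measure_display) (T : measurableType d).
Variables (P : probability T R) (eps : nat -> {RV P >-> R}) (v : R).
Hypothesis eps_indep : mutually_independent [set t : nat | (1 <= t)%N] eps.
Hypothesis eps_ident : identically_distributed [set t : nat | (1 <= t)%N] eps.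
Hypothesis eps_mean : forall t : nat, (1 <= t)%N -> expectation P (eps t) = 0%E.
Hypothesis eps_var : forall t : nat, (1 <= t)%N ->
  expectation P (fun w => eps t w ^+ 2) = v%:E.
Hypothesis v0 : 0 < v.

Let eps_int1 t : (0 < t)%N -> (\int[P]_w (eps t w)%:E = 0)%E.
Proof. by move=> t0; rewrite -(eps_mean t0) unlock. Qed.

Let eps_int2 t : (0 < t)%N -> (\int[P]_w (eps t w ^+ 2)%:E = v%:E)%E.
Proof. by move=> t0; rewrite -(eps_var t0) unlock. Qed.

Let meps2 t : measurable_fun setT (fun w => eps t w ^+ 2).
Proof. exact: measurable_funX. Qed.

Let eps_intble2 t : (0 < t)%N -> intble P (fun w => eps t w ^+ 2).
Proof.
move=> t0; apply/integrableP; split; first exact/measurable_EFinP.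
under eq_integral do rewrite gee0_abs ?lee_fin ?sqr_ge0//.
by rewrite eps_int2// ltry.
Qed.

Lemma integral_sum_le (X : nat -> T -> R) (C : nat -> R) m n :
  (forall s, (m <= s)%N -> measurable_fun setT (X s)) ->
  (forall s w, 0 <= X s w) ->
  (forall s, (m <= s < n)%N -> (\int[P]_w (X s w)%:E <= (C s)%:E)%E) ->
  (\int[P]_w (\sum_(m <= s < n) X s w)%:E <= (\sum_(m <= s < n) C s)%:E)%E.
Proof.
move=> mX X0; elim: n => [|n IH] XC.
  by rewrite big_geq//; under eq_integral do rewrite big_geq//; rewrite integral0.
have [mn|nm] := leqP m n; last first.
  by rewrite big_geq//; under eq_integral do rewrite big_geq//; rewrite integral0.
rewrite big_nat_recr//=; under eq_integral do rewrite big_nat_recr//= EFinD.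
rewrite ge0_integralD//=.
- rewrite EFinD leeD//; last by apply: XC; rewrite mn ltnSn.
  by apply: IH => s /andP[ms sn]; apply: XC; rewrite ms ltnS ltnW.
- by move=> w _; rewrite lee_fin sumr_ge0.
- by apply/measurable_EFinP; apply: measurable_sum_nat => s /andP[ms _]; exact: mX.
- by move=> w _; rewrite lee_fin.
- by apply/measurable_EFinP; exact: mX.
Qed.

Let mid : measurable_fun [set: R] (fun x : R => x) := @measurable_id _ _ _.

Let martE m n (X : nat -> T -> R) (C : nat -> R) : (0 < m <= n)%N ->
  (forall s, (m <= s)%N -> past_fun eps s (X s)) ->
  (forall s, (m <= s)%N -> intble P (fun w => X s w ^+ 2)) ->
  (forall s, (m <= s < n)%N -> (\int[P]_w (X s w ^+ 2)%:E <= (C s)%:E)%E) ->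
  past_fun eps n (fun w => \sum_(m <= s < n) X s w * eps s w) /\
  (\int[P]_w ((\sum_(m <= s < n) X s w * eps s w) ^+ 2)%:E <=
    (v * \sum_(m <= s < n) C s)%:E)%E.
Proof.
move=> /andP[m0 mn] pX iX XC.
have [pM _ _ ->] := martingale_sqr_integral eps_indep mid
  (fun t t0 => conj (eps_intble2 t0) (eps_int2 t0)) eps_int1 m0 pX iX mn.
split=> //; rewrite EFinM lee_wpmul2l ?lee_fin ?(ltW v0)//.
apply: integral_sum_le => // [s ms|s w]; last exact: sqr_ge0.
by apply: measurable_funX; exact: past_fun_measurable (pX _ ms).
Qed.

Let x w t := eps t w.

Lemma noise_sqr_ub : \forall w \ae P,
  poly_ub 1 (fun n => \sum_(1 <= t < n.+1) x w t ^+ 2).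
Proof.
pose Z n w := \sum_(1 <= t < n.+1) x w t ^+ 2.
have : \forall w \ae P, forall dl : R, 0 < dl ->
    \forall k \near \oo, Z (2 ^ k)%N w <= (2 ^ k)%N%:R `^ (1 + dl).
  apply: (@as_poly_ub_pow2 _ _ _ _ Z 1 v) => //.
  - by move=> n; apply: measurable_sum_nat => s _; exact: meps2.
  - by move=> n w; apply: sumr_ge0 => t _; exact: sqr_ge0.
  - move=> n n0; apply: (@le_trans _ _ (\sum_(1 <= s < n.+1) v)%:E).
      apply: integral_sum_le => [s _|s w|s /andP[s1 _]]; first exact: meps2.
        exact: sqr_ge0.
      by rewrite eps_int2.
    by rewrite sumr_const_nat subn1 /= lee_fin powRr1// mulr_natr.
apply: filterS => w; apply: poly_ub_dyadic => // m n mn.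
rewrite /Z [leRHS](@big_cat_nat _ _ _ m.+1)//= lerDl.
by apply: sumr_ge0 => t _; exact: sqr_ge0.
Qed.

Variable th : R.
Hypothesis th2 : th * th = 1.

Let S w t := \sum_(1 <= s < t.+1) th ^+ s * x w s.

Let past_th s : past_fun eps s (fun=> th ^+ s).
Proof. exact: measurable_cst. Qed.

Let past_S s : past_fun eps s (fun w => \sum_(1 <= i < s) th ^+ i * x w i).
Proof.
apply: measurable_sum_nat => i /andP[i1 si]; apply: measurable_funM => //.
by apply: past_fun_eps; rewrite i1.
Qed.

Let sqrth s : (th ^+ s) ^+ 2 = 1.
Proof. by rewrite -exprM mulnC exprM expr2 th2 expr1n. Qed.

Let S_int t : (\int[P]_w (S w t ^+ 2)%:E <= (v * t%:R)%:E)%E.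
Proof.
have [|_] := @martE 1 t.+1 (fun s _ => th ^+ s) (fun=> 1) isT (fun s _ => @past_th s)
  (fun s _ => intble_cst P ((th ^+ s) ^+ 2)).
  by move=> s _; rewrite sqrth integral_cst// [X in (_ * X)%E]probability_setT mule1.
by rewrite sumr_const_nat subn1.
Qed.

Let mS t : measurable_fun setT (fun w => S w t).
Proof. exact: past_fun_measurable (@past_S t.+1). Qed.

Lemma walk_sqr_ub : \forall w \ae P,
  poly_ub 2 (fun n => \sum_(1 <= t < n.+1) S w t ^+ 2).
Proof.
pose Z n w := \sum_(1 <= t < n.+1) S w t ^+ 2.
have : \forall w \ae P, forall dl : R, 0 < dl ->
    \forall k \near \oo, Z (2 ^ k)%N w <= (2 ^ k)%N%:R `^ (2 + dl).
  apply: (@as_poly_ub_pow2 _ _ _ _ Z 2 v) => //.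
  - by move=> n; apply: measurable_sum_nat => s _; exact: measurable_funX.
  - by move=> n w; apply: sumr_ge0 => t _; exact: sqr_ge0.
  - move=> n n0; apply: (@le_trans _ _ (\sum_(1 <= s < n.+1) (v * s%:R))%:E).
      apply: integral_sum_le => [s _|s w|s _]; first exact: measurable_funX.
        exact: sqr_ge0.
      exact: S_int.
    rewrite lee_fin powR_mulrn// expr2 -mulr_sumr ler_wpM2l ?(ltW v0)//.
    apply: (@le_trans _ _ (\sum_(1 <= s < n.+1) n%:R)).
      by apply: ler_sum_nat => s /andP[_ sn]; rewrite ler_nat.
    by rewrite sumr_const_nat subn1 /= -[leLHS]mulr_natr.
apply: filterS => w; apply: poly_ub_dyadic => // m n mn.
rewrite /Z [leRHS](@big_cat_nat _ _ _ m.+1)//= lerDl.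
by apply: sumr_ge0 => t _; exact: sqr_ge0.
Qed.

Let ident_integral (h : R -> R) t : (0 < t)%N -> measurable_fun setT h ->
  (forall y, 0 <= h y) ->
  (\int[P]_w (h (eps t w))%:E = \int[P]_w (h (eps 1%N w))%:E)%E.
Proof.
move=> t0 mh h0.
have mH : measurable_fun setT (EFin \o h) by exact/measurable_EFinP.
have H0 y : (0 <= (EFin \o h) y)%E by rewrite lee_fin.
rewrite -(@ge0_integral_distribution _ _ _ _ _ P (eps t) _ mH H0).
rewrite -(@ge0_integral_distribution _ _ _ _ _ P (eps 1%N) _ mH H0).
by apply: eq_measure_integral => B mB _; apply: (eps_ident (i := t) (j := 1%N)).
Qed.

(** A bounded substitute for the square: its centred sums have finite variance even if the noise has
    no fourth moment. *)
Let trunc (y : R) := Num.min (y ^+ 2) 1.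

Let mtrunc : measurable_fun setT trunc.
Proof. by apply: measurable_minr => //; exact: measurable_funX. Qed.

Let trunc_ge0 y : 0 <= trunc y.
Proof. by rewrite le_min sqr_ge0 ler01. Qed.

Let trunc_le1 y : trunc y <= 1.
Proof. by rewrite ge_min lexx orbT. Qed.

Let intble_trunc t : intble P (fun w => trunc (eps t w)).
Proof.
apply: intble_le (intble_cst P 1); first exact: measurableT_comp.
by move=> w; rewrite ger0_norm.
Qed.

Let mu := fine (\int[P]_w (trunc (eps 1%N w))%:E)%E.

Let muE t : (0 < t)%N -> (\int[P]_w (trunc (eps t w))%:E = mu%:E)%E.
Proof.
move=> t0; rewrite ident_integral// /mu fineK//.
exact: integrable_fin_num (intble_trunc 1).
Qed.

(** If [mu] vanished, the truncated square and hence the square of [eps 1] would be zero almost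
    surely, against [0 < v]. *)
Let mu_gt0 : 0 < mu.
Proof.
have mu0 : 0 <= mu by apply: fine_ge0; apply: integral_ge0 => w _; rewrite lee_fin.
rewrite lt_neqAle mu0 andbT; apply/negP => /eqP mu_eq0.
have mT : measurable_fun setT (fun w => (trunc (eps 1%N w))%:E).
  by apply/measurable_EFinP; exact: measurableT_comp.
have /(ae_eq_integral_abs P measurableT mT) z : (\int[P]_w `|(trunc (eps 1%N w))%:E| = 0)%E.
  under eq_integral do rewrite gee0_abs ?lee_fin//.
  by rewrite muE// -mu_eq0.
have : (\int[P]_w (eps 1%N w ^+ 2)%:E = \int[P]_w 0)%E.
  apply: ae_eq_integral => //; first exact/measurable_EFinP.
  apply: filterS z => w /(_ Logic.I) /= [z] _; congr _%:E.
  move: z; rewrite /trunc /Num.min; case: ifP => // _ /eqP; by rewrite oner_eq0.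
by rewrite eps_int2// integral0 => -[v_eq0]; move: v0; rewrite v_eq0 ltxx.
Qed.

Lemma noise_trunc_dyadic : \forall w \ae P, \forall k \near \oo,
  (\sum_(1 <= t < (2 ^ k).+1) (Num.min (x w t ^+ 2) 1 - mu)) ^+ 2 <=
  (2 ^ k)%N%:R `^ (1 + 1 / 2).
Proof.
pose g (y : R) := trunc y - mu.
have mg : measurable_fun setT g by exact: measurable_funB.
have mu1 : `|mu| <= 1.
  rewrite gtr0_norm// -lee_fin -(muE (t := 1%N))//.
  apply: (@le_trans _ _ (\int[P]_w 1%:E)%E).
    apply: ge0_le_integral => //.
    - by move=> w _; rewrite lee_fin.
    - by apply/measurable_EFinP; exact: measurableT_comp.
    - by move=> w _; rewrite lee_fin.
  by rewrite integral_cst// [X in (_ * X)%E]probability_setT mule1.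
have g2i t : intble P (fun w => g (eps t w) ^+ 2).
  apply: intble_le (intble_cst P 4); first by apply: measurable_funX; exact: measurableT_comp.
  move=> w; rewrite ger0_norm ?sqr_ge0// -real_normK ?num_real//.
  have h1 : `|g (eps t w)| <= 2.
    apply: (le_trans (ler_normB _ _)); rewrite (_ : 2 = 1 + 1)// lerD//.
    by rewrite ger0_norm.
  by have := normr_ge0 (g (eps t w)); nra.
pose v' := fine (\int[P]_w (g (eps 1%N w) ^+ 2)%:E)%E.
have v'0 : 0 <= v' by apply: fine_ge0; apply: integral_ge0 => w _; rewrite lee_fin sqr_ge0.
have g2 t : (0 < t)%N -> intble P (fun w => g (eps t w) ^+ 2) /\
    (\int[P]_w (g (eps t w) ^+ 2)%:E = v'%:E)%E.
  move=> t0; split => //.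
  rewrite (ident_integral (h := fun y => g y ^+ 2))//.
  - by rewrite /v' fineK//; exact: integrable_fin_num (g2i 1%N).
  - exact: measurable_funX.
  - by move=> y; exact: sqr_ge0.
have g1 t : (0 < t)%N -> (\int[P]_w (g (eps t w))%:E = 0)%E.
  move=> t0; have [_] := intbleD (intble_trunc t) (intble_cst P (- mu)).
  rewrite muE// integral_cst// [X in (_ * X)%E]probability_setT mule1 => ->.
  by rewrite -EFinD subrr.
pose Z n w := (\sum_(1 <= t < n.+1) g (x w t)) ^+ 2.
have : \forall w \ae P, forall dl : R, 0 < dl ->
    \forall k \near \oo, Z (2 ^ k)%N w <= (2 ^ k)%N%:R `^ (1 + dl).
  (* [v'] can vanish, for instance for noise with values [1] and [-1]; adding [1] makes the constant
     positive. *)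
  apply: (@as_poly_ub_pow2 _ _ _ _ Z 1 (v' + 1)) => //.
  - move=> n; apply: measurable_funX; apply: measurable_sum_nat => s _.
    exact: measurableT_comp.
  - by move=> n w; exact: sqr_ge0.
  - by rewrite ltr_wpDl.
  - move=> n n0.
    have [_ _ _] := martingale_sqr_integral eps_indep mg g2 g1 (m := 1%N)
      (X := fun _ _ => 1) isT (fun s _ => @measurable_cst _ _ _ _ _ _)
      (fun s _ => intble_cst P _) (isT : (1 <= n.+1)%N).
    under eq_integral do under eq_bigr do rewrite mul1r.
    move=> ->; under eq_integral do rewrite expr1n sumr_const_nat subn1 /=.
    rewrite integral_cst// [X in (_ * (_ * X))%E]probability_setT mule1 -EFinM lee_fin.
    by rewrite powRr1// ler_wpM2r// lerDl.
by apply: filterS => w; apply; lra.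
Qed.

(** Indexed by the later of the two times, the sum is a transform of [eps s] by the past value
    [x w (s - (j - i))], so its second moment is at most [v * v * n]. *)
Lemma noise_cross p (i j : 'I_p) : (i < j)%N ->
  \forall w \ae P, \forall k \near \oo,
    (\sum_(p.+1 <= t < (2 ^ k).+1) x w (t - i)%N * x w (t - j)%N) ^+ 2
    <= (2 ^ k)%N%:R `^ (1 + 1 / 2).
Proof.
move=> ij; have jp := ltn_ord j.
pose Z n w := (\sum_(p.+1 <= t < n.+1) x w (t - i)%N * x w (t - j)%N) ^+ 2.
have : \forall w \ae P, forall dl : R, 0 < dl ->
    \forall k \near \oo, Z (2 ^ k)%N w <= (2 ^ k)%N%:R `^ (1 + dl).
  apply: (@as_poly_ub_pow2 _ _ _ _ Z 1 (v * v)) => //.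
  - move=> n; apply: measurable_funX; apply: measurable_sum_nat => s _.
    exact: measurable_funM.
  - by move=> n w; exact: sqr_ge0.
  - by rewrite mulr_gt0.
  - move=> n n0; have [np|pn] := ltnP n p.
      under eq_integral do rewrite /Z big_geq ?(leqW np)// expr0n.
      by rewrite integral0 lee_fin mulr_ge0 ?powR_ge0// ltW// mulr_gt0.
    have e : p.+1 = ((p - i).+1 + i)%N by lia.
    have ZE w : Z n w = (\sum_((p - i).+1 <= s < n.+1 - i)
        x w (s - (j - i))%N * eps s w) ^+ 2.
      rewrite /Z e big_addn; congr (_ ^+ 2); apply: eq_bigr => s _.
      rewrite addnK mulrC; congr (x w _ * _); lia.
    under eq_integral do rewrite ZE.
    have pi : (0 < (p - i).+1 <= n.+1 - i)%N by lia.
    have [||s /andP[ps _]|_] := @martE _ _ (fun s w => x w (s - (j - i))%N) (fun=> v) pi.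
    + by move=> s ps; apply: past_fun_eps; lia.
    + by move=> s ps; apply: eps_intble2; lia.
    + by rewrite eps_int2//; lia.
    + move/le_trans; apply; rewrite lee_fin sumr_const_nat powRr1// -mulrA.
      by rewrite ler_wpM2l ?(ltW v0)// -[leLHS]mulr_natr ler_wpM2l ?(ltW v0)// ler_nat; lia.
by apply: filterS => w; apply; lra.
Qed.

Lemma noise_excited p : \forall w \ae P, \forall n \near \oo,
  forall c : 'I_p -> R, mu / 4 * n%:R * (\sum_i c i ^+ 2) <=
    \sum_(p.+1 <= t < n.+1) (\sum_i c i * x w (t - i)%N) ^+ 2.
Proof.
have cross : \forall w \ae P, forall i j : 'I_p, (i < j)%N -> \forall k \near \oo,
    (\sum_(p.+1 <= t < (2 ^ k).+1) x w (t - i)%N * x w (t - j)%N) ^+ 2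
    <= (2 ^ k)%N%:R `^ (1 + 1 / 2).
  apply: filter_forall => i; apply: filter_forall => j.
  have [ij|_] := boolP (i < j)%N; last exact: aeW.
  by apply: filterS (noise_cross ij).
apply: filterS2 noise_trunc_dyadic cross => w h1 h2.
exact: excitation_dyadic.
Qed.

Lemma noise_persistently_excited p : \forall w \ae P, exists2 k : R, 0 < k &
  \forall n \near \oo, forall c : 'I_p -> R, k * n%:R * (\sum_i c i ^+ 2) <=
    \sum_(p.+1 <= t < n.+1) (\sum_i c i * x w (t - i)%N) ^+ 2.
Proof.
by apply: filterS (noise_excited p) => w h; exists (mu / 4); rewrite ?divr_gt0.
Qed.

(** The excitation bound with one lag and [c = 1]. There the sum starts at [t = 2], so the first
    square is added back. *)
Lemma noise_sqr_lb : \forall w \ae P, \forall n \near \oo,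
  mu / 4 * n%:R <= \sum_(1 <= t < n.+1) x w t ^+ 2.
Proof.
apply: filterS (noise_excited 1) => w; apply: filterS => n /(_ (fun=> 1)).
rewrite big_ord1 expr1n mulr1 => /le_trans; apply.
have [n0|n0] := posnP n; first by rewrite n0 !big_geq.
rewrite [leRHS]big_ltn// addrC.
rewrite (eq_bigr (fun t => x w t ^+ 2)).
  by rewrite lerDl sqr_ge0.
by move=> t _; rewrite big_ord1 mul1r subn0.
Qed.

(** The cutoff at time [s] only looks at the walk before [s], so the integrand stays predictable. *)
Let past_stopped a s : past_fun eps s (fun w => stopped_walk (x w) th a s).
Proof.
apply: measurable_fun_ifT => //.
- apply: measurable_fun_ler; last exact: measurable_cst.
  apply: measurable_sum_nat => r /andP[_ rs]; apply: measurable_funX.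
  by apply: past_funS (@past_S r.+1).
- by apply: measurable_funM => //; exact: past_S.
Qed.

Let stopped_le a s w : 0 <= a -> stopped_walk (x w) th a s ^+ 2 <= a.
Proof.
move=> a0; case: s => [|s].
  rewrite /stopped_walk !big_geq//.
  by case: ifP; rewrite ?mulr0 expr0n.
apply: le_trans (stopped_walk_sqr_sum (x w) th2 s.+1 a0).
rewrite [leRHS]big_nat_recr//= lerDr.
by apply: sumr_ge0 => t _; exact: sqr_ge0.
Qed.

(** For fixed [dl], the stopped integrals at level [A n] have second moments at most [v * A n].
    [Z n] need not be monotone, as its level moves with [n], so it is only used along powers of two;
    monotonicity is invoked for the sum of squares of the walk. *)
Lemma walk_sqr_lb : \forall w \ae P,
  poly_lb 2 (fun n => \sum_(1 <= t < n.+1) S w t ^+ 2).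
Proof.
have fixed_dl dl : 0 < dl -> \forall w \ae P, \forall k \near \oo,
    (2 ^ k)%N%:R `^ (2 - dl) <= \sum_(1 <= t < (2 ^ k).+1) S w t ^+ 2.
  move=> dl0; pose A n : R := n%:R `^ (2 - dl).
  pose Z n w := \sum_(1 <= t < n.+1)
    (\sum_(1 <= s < t.+1) stopped_walk (x w) th (A n) s * x w s) ^+ 2.
  have A0 n : 0 <= A n by exact: powR_ge0.
  have iX n s : (1 <= s)%N -> intble P (fun w => stopped_walk (x w) th (A n) s ^+ 2).
    move=> _; apply: intble_le (intble_cst P (A n)).
      by apply: measurable_funX; exact: past_fun_measurable (@past_stopped _ s).
    by move=> w; rewrite ger0_norm ?sqr_ge0// stopped_le.
  have mart n t := martingale_sqr_integral eps_indep mid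
    (fun t t0 => conj (eps_intble2 t0) (eps_int2 t0)) eps_int1 (m := 1%N)
    (X := fun s w => stopped_walk (x w) th (A n) s) isT
    (fun s _ => @past_stopped (A n) s) (iX n) (isT : (1 <= t.+1)%N).
  have mZ n t : measurable_fun setT (fun w =>
      (\sum_(1 <= s < t.+1) stopped_walk (x w) th (A n) s * x w s) ^+ 2).
    by have [pM _ _ _] := mart n t; apply: measurable_funX; exact: past_fun_measurable pM.
  have : \forall w \ae P, forall d' : R, 0 < d' ->
      \forall k \near \oo, Z (2 ^ k)%N w <= (2 ^ k)%N%:R `^ (3 - dl + d').
    apply: (@as_poly_ub_pow2 _ _ _ _ Z (3 - dl) v) => //.
    - by move=> n; apply: measurable_sum_nat => t _; exact: mZ.
    - by move=> n w; apply: sumr_ge0 => t _; exact: sqr_ge0.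
    - move=> n n0; apply: (@le_trans _ _ (\sum_(1 <= s < n.+1) (v * A n))%:E).
        apply: integral_sum_le => [s _|s w|t _]; [exact: mZ|exact: sqr_ge0|].
        have [_ _ iQ ->] := mart n t.
        rewrite EFinM lee_wpmul2l ?lee_fin ?(ltW v0)//.
        apply: (@le_trans _ _ (\int[P]_w (A n)%:E)%E); last first.
          by rewrite integral_cst// [X in (_ * X)%E]probability_setT mule1.
        apply: ge0_le_integral => //.
        + by move=> w _; rewrite lee_fin sumr_ge0// => s _; exact: sqr_ge0.
        + by move/integrableP : iQ => [].
        + by move=> w _; rewrite lee_fin; exact: stopped_walk_sqr_sum.
      rewrite sumr_const_nat subn1 /= lee_fin -[leLHS]mulr_natr -mulrA.
      rewrite ler_wpM2l ?(ltW v0)// -[X in _ * X]powRr1// /A -natr_powRD//.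
      by rewrite natr_powR_le//; lra.
  move=> hZ; apply: filterS2 noise_sqr_lb hZ => w h1 h2.
  by apply: (walk_lb_dyadic th2 _ dl0 h1) => //; [rewrite divr_gt0|apply: h2; lra].
have H (j : nat) : \forall w \ae P, \forall k \near \oo,
    (2 ^ k)%N%:R `^ (2 - j.+1%:R^-1) <= \sum_(1 <= t < (2 ^ k).+1) S w t ^+ 2.
  by apply: fixed_dl; rewrite invr_gt0.
have := ae_foralln H; apply: filterS => w Hw.
apply: poly_lb_dyadic => // [m n mn|dl dl0 _].
  rewrite [leRHS](@big_cat_nat _ _ _ m.+1)//= lerDl.
  by apply: sumr_ge0 => t _; exact: sqr_ge0.
have [j _ /(_ j (leqnn _)) jdl] := near_infty_natSinv_lt (PosNum dl0).
apply: filterS (Hw j) => k; apply: le_trans.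
by rewrite natr_powR_le ?expn_gt0// lerD2l lerN2 ltW.
Qed.

End Noise.

(** * Almost sure limit of the log determinant *)

Theorem theorem1 (R : realType) (d : measure_display) (Omega : measurableType d)
    (P : probability Omega R) (p q : nat)
    (eps : nat -> {RV P >-> R}) (y : int -> {RV P >-> R})
    (sigma alpha : R) (beta psi : nat -> R)
    (eps_indep : mutually_independent [set t : nat | (1 <= t)%N] eps)
    (eps_ident : identically_distributed [set t : nat | (1 <= t)%N] eps)
    (eps_mean : forall t : nat, (1 <= t)%N ->
       expectation P (eps t) = 0%E)
    (eps_var : forall t : nat, (1 <= t)%N ->
       expectation P (fun w => eps t w ^+ 2) = (sigma ^+ 2)%:E)
    (sigma_pos : 0 < sigma ^+ 2)
    (alpha_gt2 : 2 < alpha)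
    (eps_moment : forall t : nat, (1 <= t)%N ->
       (expectation P (fun w => powR `|eps t w| alpha) < +oo)%E)
    (ar_eq : forall (t : nat) (w : Omega), (1 <= t)%N ->
       y t%:Z w =
       \sum_(1 <= i < p.+1) beta i * y (t%:Z - i%:Z) w + eps t w)
    (init_indep : independent_families
       [set k : int | 1 - p%:Z <= k <= 0] y [set t : nat | (1 <= t)%N] eps)
    (p_eq : p = (q + 2)%N)
    (phi_factor : ar_poly p beta = (1 - 'X) * (1 + 'X) * ar_poly q psi)
    (psi_order : size (ar_poly q psi) = q.+1)
    (psi_roots : forall z : R[i],
       root (map_poly (real_complex R) (ar_poly q psi)) z -> 1 < `|z|) :
  \forall w \ae P,
    (fun n : nat => (ln n%:R)^-1 * ln (\det (lag_gram p (fun k => y k w) n)))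
      @ \oo --> (p%:R + 2 : R).
Proof.
have th2 b : (-1) ^+ b * (-1) ^+ b = 1 :> R.
  by rewrite -expr2 sqrr_sign.
have sq := noise_sqr_ub eps_var sigma_pos.
have walk_ub : \forall w \ae P, forall b : bool, poly_ub 2 (fun n =>
    \sum_(1 <= t < n.+1) (\sum_(1 <= s < t.+1) ((-1) ^+ b) ^+ s * eps s w) ^+ 2).
  apply: filter_forall => b.
  exact: (walk_sqr_ub eps_indep eps_mean eps_var sigma_pos (th2 b)).
have walk_lb : \forall w \ae P, forall b : bool, poly_lb 2 (fun n =>
    \sum_(1 <= t < n.+1) (\sum_(1 <= s < t.+1) ((-1) ^+ b) ^+ s * eps s w) ^+ 2).
  apply: filter_forall => b.
  exact: (walk_sqr_lb eps_indep eps_ident eps_mean eps_var sigma_pos (th2 b)).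
have exc := noise_persistently_excited eps_indep eps_ident eps_mean eps_var sigma_pos p.
have walk : \forall w \ae P, forall b : bool,
    poly_ub 2 (fun n => \sum_(1 <= t < n.+1)
      (\sum_(1 <= s < t.+1) ((-1) ^+ b) ^+ s * eps s w) ^+ 2) /\
    poly_lb 2 (fun n => \sum_(1 <= t < n.+1)
      (\sum_(1 <= s < t.+1) ((-1) ^+ b) ^+ s * eps s w) ^+ 2).
  by apply: filterS2 walk_ub walk_lb => w h1 h2 b.
apply: filterS3 sq exc walk => w h1 [k k0 h2] h3.
pose yw i := y i w.
(* From here on the argument is pathwise. The filtered path agrees with the noise at times [t >= 1],
   which are the only times at which the sums below evaluate it. *)
have yE t : (0 < t)%N ->
    lag ((1 - 'X) * (1 + 'X) * ar_poly q psi) yw t%:Z = eps t w.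
  move=> t0; rewrite -phi_factor lag_ar_poly /yw ar_eq//.
  by rewrite addrAC subrr add0r.
have pq : p = q.+2 by rewrite p_eq addn2.
move: h2 pq; clear -h1 h3 yE psi_order psi_roots k0 => h2 pq; subst p.
have eS b t : sgn_sum b (lag ((1 - 'X) * (1 + 'X) * ar_poly q psi) yw) t =
    \sum_(1 <= s < t.+1) ((-1) ^+ b) ^+ s * eps s w.
  by apply: eq_big_nat => s /andP[s0 _]; rewrite yE.
have eSS b : (fun n => \sum_(1 <= t < n.+1)
    sgn_sum b (lag ((1 - 'X) * (1 + 'X) * ar_poly q psi) yw) t ^+ 2) =
    (fun n => \sum_(1 <= t < n.+1)
      (\sum_(1 <= s < t.+1) ((-1) ^+ b) ^+ s * eps s w) ^+ 2).
  by apply/funext => n; apply: eq_bigr => t _; rewrite eS.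
apply: (gram_det_order psi_order psi_roots (y := yw)).
- rewrite [X in poly_ub _ X](_ : _ = fun n => \sum_(1 <= t < n.+1) eps t w ^+ 2)//.
  apply/funext => n; apply: eq_big_nat => t /andP[t0 _]; by rewrite yE.
- by move=> b; rewrite eSS; case: (h3 b).
- by move=> b; rewrite eSS; case: (h3 b).
exists k => //; apply: filterS h2 => n h c; apply: (le_trans (h c)).
rewrite le_eqVlt; apply/orP; left; apply/eqP; apply: eq_big_nat => t /andP[pt _].
congr (_ ^+ 2); apply: eq_bigr => i _; congr (_ * _).
(* As [i < t], the truncated difference [t - i] is the integer one and is positive, so [yE]
   applies. *)
have it := leq_trans (ltn_ord i) (ltnW pt).
by rewrite subzn ?(ltnW it)// yE// subn_gt0.
Qed.
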